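(* The All-the-Same-SAT problem restricted to 3-CNF$_{\leq 4}$ formulae is NP-complete.
   Context: A 3-CNF formula is a conjunction of clauses, each clause being a disjunction of exactly three literal occurrences (a literal is a propositional variable $v$ or its negation $\lnot v$; the same literal may occur more than once in a clause, e.g. $x\vee x\vee\lnot x$). A 3-CNF$_{\leq 4}$ formula is a 3-CNF formula in which each variable occurs at most $4$ times. The All-the-Same-SAT problem: given a 3-CNF formula, decide whether there is a truth assignment (valuation) of its variables under which every clause has exactly the same number of true literal occurrences (this common number may be $0$, so the valuation need not satisfy the formula). *)

(* Defs.v *)
From Stdlib Require Import BinNums BinPos.
From mathcomp Require Import all_boot.
Set Implicit Arguments. Unset Strict Implicit. Unset Printing Implicit Defensive.

(* A literal is (s, v): the variable v (a natural number) if s = true,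
   its negation if s = false.  A clause consists of exactly three literal
   occurrences (repetitions allowed).  A 3-CNF formula is a list of clauses. *)
Definition literal := (bool * nat)%type.
Definition clause := (literal * literal * literal)%type.
Definition formula := seq clause.

Definition clause_lits (c : clause) : seq literal :=
  let: (a, b, d) := c in [:: a; b; d].

Definition occurrences (F : formula) (v : nat) : nat :=
  count (fun l : literal => l.2 == v) (flatten (map clause_lits F)).

Definition is_3cnf_le4 (F : formula) : Prop := forall v, occurrences F v <= 4.

Definition lit_val (val : nat -> bool) (l : literal) : bool := val l.2 == l.1.

Definition ntrue (val : nat -> bool) (c : clause) : nat :=
  count (lit_val val) (clause_lits c).

Definition all_the_same_sat (F : formula) : Prop :=
  exists (val : nat -> bool) (k : nat), all (fun c => ntrue val c == k) F.

Fixpoint pos_bits (p : positive) : seq bool :=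
  match p with
  | xI q => true :: pos_bits q
  | xO q => false :: pos_bits q
  | xH => [::]
  end.

(* binary representation of n (of n+1 without its leading 1, LSB first) *)
Definition nat_bits (n : nat) : seq bool := pos_bits (Pos.of_succ_nat n).

(* self-delimiting code: data bit b |-> [true; b], end marker [false; false] *)
Definition data_bits (s : seq bool) : seq bool :=
  flatten (map (fun b => [:: true; b]) s).

Definition enc_lit (l : literal) : seq bool :=
  [:: true; l.1] ++ data_bits (nat_bits l.2) ++ [:: false; false].

Definition enc_formula (F : formula) : seq bool :=
  flatten (map (fun c => flatten (map enc_lit (clause_lits c))) F).

Definition ATS_3CNF4 (w : seq bool) : Prop :=
  exists F : formula, w = enc_formula F /\ is_3cnf_le4 F /\ all_the_same_sat F.

Inductive move := MvL | MvR | MvS.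

(* States: 'I_(tm_Q.+1); tape symbols: 'I_(tm_S.+3), where symbol 0 is the
   blank, 1 encodes the bit false and 2 the bit true. *)
Record TM := {
  tm_Q : nat;
  tm_S : nat;
  tm_start : 'I_tm_Q.+1;
  tm_acc : 'I_tm_Q.+1;
  tm_rej : 'I_tm_Q.+1;
  tm_delta : 'I_tm_Q.+1 -> 'I_tm_S.+3 -> ('I_tm_Q.+1 * 'I_tm_S.+3 * move)
}.

Definition state (M : TM) := 'I_(tm_Q M).+1.
Definition sym (M : TM) := 'I_(tm_S M).+3.

(* configuration: state, (left part reversed, scanned symbol, right part) *)
Definition config (M : TM) := (state M * (seq (sym M) * sym M * seq (sym M)))%type.

Definition blank (M : TM) : sym M := ord0.
Definition sym_of_bool (M : TM) (b : bool) : sym M := if b then inord 2 else inord 1.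

Definition halted (M : TM) (c : config M) : bool :=
  (c.1 == tm_acc M) || (c.1 == tm_rej M).

Definition step (M : TM) (c : config M) : config M :=
  if halted c then c else
  let: (q, (l, a, r)) := c in
  let: (q', b, m) := tm_delta q a in
  match m with
  | MvS => (q', (l, b, r))
  | MvR => match r with
           | [::] => (q', (b :: l, @blank M, [::]))
           | x :: r' => (q', (b :: l, x, r'))
           end
  | MvL => match l with
           | [::] => (q', ([::], b, r))
           | x :: l' => (q', (l', x, b :: r))
           end
  end.

Definition run (M : TM) (n : nat) (c : config M) : config M := iter n (@step M) c.

Definition init (M : TM) (w : seq bool) : config M :=
  match map (@sym_of_bool M) w with
  | [::] => (tm_start M, ([::], @blank M, [::]))
  | x :: r => (tm_start M, ([::], x, r))
  end.

Definition bit_of_sym (M : TM) (s : sym M) : option bool :=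
  if val s == 1 then Some false else if val s == 2 then Some true else None.

Fixpoint read_bits (M : TM) (s : seq (sym M)) : seq bool :=
  match s with
  | [::] => [::]
  | x :: s' => match bit_of_sym x with
               | Some b => b :: read_bits s'
               | None => [::]
               end
  end.

Definition output (M : TM) (c : config M) : seq bool :=
  let: (_, (_, a, r)) := c in read_bits (a :: r).

Definition poly_bound (k n : nat) : nat := k * n ^ k + k.

Definition language := seq bool -> Prop.

Definition decides_in_poly_time (M : TM) (L : language) : Prop :=
  exists k, forall w, let c := @run M (poly_bound k (size w)) (@init M w) in
    halted c /\ ((c.1 == tm_acc M) <-> L w).

Definition in_P (L : language) : Prop := exists M, decides_in_poly_time M L.

Definition computes_in_poly_time (M : TM) (f : seq bool -> seq bool) : Prop :=
  exists k, forall w, let c := @run M (poly_bound k (size w)) (@init M w) in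
    halted c /\ output c = f w.

Definition in_FP (f : seq bool -> seq bool) : Prop := exists M, computes_in_poly_time M f.

Definition pair_enc (w y : seq bool) : seq bool := data_bits w ++ [:: false; false] ++ y.

Definition in_NP (L : language) : Prop :=
  exists V : language, in_P V /\ exists k, forall w,
    L w <-> exists y : seq bool, size y <= poly_bound k (size w) /\ V (pair_enc w y).

Definition poly_reduces (L1 L2 : language) : Prop :=
  exists f, in_FP f /\ forall w, L1 w <-> L2 (f w).

Definition NP_hard (L : language) : Prop := forall L', in_NP L' -> poly_reduces L' L.

Definition NP_complete (L : language) : Prop := in_NP L /\ NP_hard L.

(* Main.v *)
Require Import Defs.
From HB Require Import structures.
From Stdlib Require Import BinNums BinPos FunctionalExtensionality.
From mathcomp Require Import all_boot zify.
Set Implicit Arguments. Unset Strict Implicit. Unset Printing Implicit Defensive.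

(** Membership: the witness lists the names of the true variables.  The verifier
    parses the word carelessly, and re-encodes the result to see whether it was
    well formed.

    Hardness: a computation tableau with variables "column [i] shows [g] at time
    [t]" is described by Horn clauses, apart from the guessed input cells.  No
    uniqueness clauses are needed: the true variables contain those of an actual
    run, and clauses excluding rejecting states at the last time do the rest.
    Schaefer's gadget turns 3-SAT into one-in-three satisfiability.  A clause
    [f, f, ~f] has [1 + f] true literals, so the common number is 1 or 2, and
    complementing the valuation if necessary makes it 1; then [f] is false, and a
    clause [v, ~v', f] says [v = v'].  Every occurrence of a variable can thus use
    its own copy, linked to the next, and each variable occurs at most 4 times.
    Since [nat_bits] is onto, variables may be named by arbitrary bit strings.

    Polynomial time: a class of functions on data encoded by binary trees is
    closed under composition, pairing and size-bounded iteration over lists.  A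
    tree is written in prefix notation on a stack, programs over four stacks are
    compiled to flat code, and that code is run by a one-tape machine whose cells
    carry one bit of each stack, the bottoms being aligned at the left end. *)

(** * Turing machines on functional tapes *)

Section TapeMachine.

Variables (Q A : Type) (halts : pred Q) (delta : Q -> A -> Q * A * move).

Definition tape_conf := (Q * nat * (nat -> A))%type.

Definition write (t : nat -> A) (h : nat) (b : A) : nat -> A :=
  fun j => if j == h then b else t j.

Definition shift (m : move) (h : nat) : nat :=
  match m with MvL => h.-1 | MvR => h.+1 | MvS => h end.

Definition tape_step (c : tape_conf) : tape_conf :=
  let: (q, h, t) := c in
  if halts q then c else
  let: (q', b, m) := delta q (t h) in (q', shift m h, write t h b).

Lemma write_same t h : write t h (t h) = t.
Proof. by apply: functional_extensionality => j; rewrite /write; case: eqP => [->|]. Qed.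

Lemma iter_tape_step_halted n c : halts c.1.1 -> iter n tape_step c = c.
Proof.
move=> halt_c; elim: n => //= n ->.
by case: c halt_c => [[q h] t] /= halt_q; rewrite /tape_step halt_q.
Qed.

Lemma iter_tape_step_stable m n c :
    halts (iter m tape_step c).1.1 -> m <= n ->
  iter n tape_step c = iter m tape_step c.
Proof. by move=> halt_m le_mn; rewrite -(subnK le_mn) iterD iter_tape_step_halted. Qed.

Lemma tape_step_head c : (tape_step c).1.2 <= c.1.2.+1.
Proof.
case: c => [[q h] t]; rewrite /tape_step; case: ifP => _ /=; first exact: leqnSn.
by case: (delta q (t h)) => [[q' b] []] /=; lia.
Qed.

Lemma iter_tape_step_head n c : (iter n tape_step c).1.2 <= c.1.2 + n.
Proof.
elim: n => [|n IH] /=; first by rewrite addn0.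
by rewrite addnS; apply: leq_trans (tape_step_head _) _.
Qed.

End TapeMachine.

Arguments tape_step : simpl never.

Section FunctionalTape.

Variable M : TM.

Definition tm_halts : pred (state M) := pred2 (tm_acc M) (tm_rej M).

Definition tm_tape_step : tape_conf (state M) (sym M) -> tape_conf (state M) (sym M) :=
  tape_step tm_halts (@tm_delta M).

Definition tm_tape_init (w : seq bool) : tape_conf (state M) (sym M) :=
  (tm_start M, 0, nth (@blank M) (map (@sym_of_bool M) w)).

Definition represents (c : config M) (f : tape_conf (state M) (sym M)) : Prop :=
  let: (q, (l, a, r)) := c in
  [/\ f.1.1 = q, f.1.2 = size l & nth (@blank M) (rev l ++ a :: r) =1 f.2].

Lemma represents_step c f : represents c f -> represents (step c) (tm_tape_step f).
Proof.
case: c => q [[l a] r]; case: f => [[_ _] t] /= [-> -> tape_eq].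
rewrite /step /halted /tm_tape_step /tape_step /tm_halts /=.
case: ifP => // _.
have -> : t (size l) = a by rewrite -tape_eq nth_cat size_rev ltnn subnn.
case: (tm_delta q a) => [[q' b] m].
have written : nth (@blank M) (rev l ++ b :: r) =1 write t (size l) b.
  move=> i; rewrite /write -tape_eq !nth_cat size_rev.
  case: (ltngtP i (size l)) => [//||->]; last by rewrite subnn.
  by case: (i - size l) (subn_gt0 (size l) i) => [|j] // <-.
case: m => /=.
- case: l {tape_eq} written => [|x l] written /=; split=> // i.
  by rewrite -written // rev_cons cat_rcons.
- case: r {tape_eq} written => [|x r] written /=; split=> // i;
    rewrite -written rev_cons cat_rcons //.
  rewrite !nth_cat size_rev; case: ltnP => // _.
  by case: (i - size l) => [|[|[]]].
- by split.
Qed.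

Lemma represents_run n c f :
  represents c f -> represents (run n c) (iter n tm_tape_step f).
Proof. by move=> repr; elim: n => //= n; apply: represents_step. Qed.

Lemma represents_init w : represents (init M w) (tm_tape_init w).
Proof.
rewrite /init /tm_tape_init; case: (map _ w) => [|x r] /=; split=> // i.
by rewrite nth_seq1 nth_nil if_same.
Qed.

Lemma represents_state c f : represents c f -> c.1 = f.1.1.
Proof. by case: c => q [[l a] r] []. Qed.

Lemma bit_of_symK : pcancel (@sym_of_bool M) (@bit_of_sym M).
Proof. by case; rewrite /bit_of_sym /sym_of_bool /= inordK. Qed.

Lemma read_bitsK s u :
    (forall j, j <= size u ->
       nth (@blank M) s j = nth (@blank M) (map (@sym_of_bool M) u) j) ->
  read_bits s = u.
Proof.
elim: s u => [|x s IH] [|b u] agree //=.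
- by have := congr1 (@bit_of_sym M) (agree 0 isT); rewrite [RHS]bit_of_symK.
- by have /= -> := agree 0 isT.
- have /= -> := agree 0 isT; rewrite bit_of_symK; congr (_ :: _).
  by apply: IH => j; apply: (agree j.+1).
Qed.

Lemma represents_output c f u :
    represents c f ->
    (forall j, j <= size u ->
       f.2 (f.1.2 + j) = nth (@blank M) (map (@sym_of_bool M) u) j) ->
  output c = u.
Proof.
case: c => q [[l a] r]; case: f => [[_ h] t] [/= _ -> tape_eq] agree.
apply: (@read_bitsK (a :: r)) => j /agree <-.
by rewrite -tape_eq nth_cat size_rev ltnNge leq_addr addKn.
Qed.

End FunctionalTape.

Section FiniteAlphabetMachine.

Variables (St Cell : finType).
Let Sym := (option bool + Cell)%type.
Variable delta : St -> Sym -> St * Sym * move.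
Variables start acc rej : St.

Definition symbols : seq Sym :=
  [:: inl None; inl (Some false); inl (Some true)] ++ map inr (enum Cell).

Lemma mem_symbols x : x \in symbols.
Proof.
case: x => [[[]|]|c] //=; rewrite !inE /=.
by apply/mapP; exists c; rewrite ?mem_enum.
Qed.

Definition enc_state (q : St) : 'I_(#|St|).+1 := inord (index q (enum St)).
Definition dec_state (i : 'I_(#|St|).+1) : St := nth start (enum St) i.
Definition enc_sym (x : Sym) : 'I_(#|Cell|).+3 := inord (index x symbols).
Definition dec_sym (i : 'I_(#|Cell|).+3) : Sym := nth (inl None) symbols i.

Lemma enc_stateK : cancel enc_state dec_state.
Proof.
move=> q; rewrite /dec_state /enc_state inordK ?nth_index ?mem_enum //.
by rewrite ltnS cardE index_size.
Qed.

Lemma enc_symK : cancel enc_sym dec_sym.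
Proof.
have size_symbols : size symbols = (#|Cell|).+3 by rewrite /= size_map -cardE.
move=> x; rewrite /dec_sym /enc_sym inordK ?nth_index ?mem_symbols //.
by rewrite -size_symbols index_mem mem_symbols.
Qed.

Definition machine : TM := {|
  tm_Q := #|St|; tm_S := #|Cell|;
  tm_start := enc_state start; tm_acc := enc_state acc; tm_rej := enc_state rej;
  tm_delta := fun q x => let: (q', b, m) := delta (dec_state q) (dec_sym x) in
                         (enc_state q', enc_sym b, m) |}.

Definition machine_step : tape_conf St Sym -> tape_conf St Sym :=
  tape_step (pred2 acc rej) delta.

Definition machine_init (w : seq bool) : tape_conf St Sym :=
  (start, 0, fun j => inl (onth w j)).

Definition embed (c : tape_conf St Sym) : tape_conf (state machine) (sym machine) :=
  let: (q, h, t) := c in (enc_state q, h, fun j => enc_sym (t j)).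

Lemma embed_step c : @tm_tape_step machine (embed c) = embed (machine_step c).
Proof.
case: c => [[q h] t]; rewrite /machine_step /tm_tape_step /tape_step /tm_halts /=.
rewrite !(can_eq enc_stateK); case: ifP => // _; rewrite /= enc_stateK enc_symK.
case: (delta q (t h)) => [[q' b] m] /=; congr (_, _).
by apply: functional_extensionality => j; rewrite /write; case: eqP.
Qed.

Lemma embed_run n c :
  iter n (@tm_tape_step machine) (embed c) = embed (iter n machine_step c).
Proof. by elim: n => //= n ->; apply: embed_step. Qed.

Lemma enc_sym_bits w j :
  nth (@blank machine) (map (@sym_of_bool machine) w) j = enc_sym (inl (onth w j)).
Proof. by elim: w j => [|[] w IH] [|j] //=; apply: val_inj; rewrite /= inordK. Qed.

Lemma embed_init w : @tm_tape_init machine w = embed (machine_init w).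
Proof.
by congr (_, _); apply: functional_extensionality => j; rewrite enc_sym_bits.
Qed.

Lemma represents_machine_run n w :
  represents (run n (init machine w)) (embed (iter n machine_step (machine_init w))).
Proof. by rewrite -embed_run -embed_init; apply/represents_run/represents_init. Qed.

Lemma machine_run_state n w q :
  ((run n (init machine w)).1 == enc_state q) =
  ((iter n machine_step (machine_init w)).1.1 == q).
Proof.
rewrite (represents_state (represents_machine_run n w)).
by case: (iter _ _ _) => [[q' h] t]; rewrite (can_eq enc_stateK).
Qed.

Lemma machine_accepts n w :
  ((run n (init machine w)).1 == tm_acc machine) =
  ((iter n machine_step (machine_init w)).1.1 == acc).
Proof. exact: machine_run_state. Qed.

Lemma machine_halted n w :
  halted (run n (init machine w)) =
  pred2 acc rej (iter n machine_step (machine_init w)).1.1.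
Proof. by rewrite /halted !machine_run_state. Qed.

Lemma machine_output n w u :
    (let c := iter n machine_step (machine_init w) in
     forall j, j <= size u -> c.2 (c.1.2 + j) = inl (onth u j)) ->
  output (run n (init machine w)) = u.
Proof.
move=> /= agree; apply: represents_output (represents_machine_run n w) _ => j le_ju.
case: (iter _ _ _) agree => [[q h] t] /= agree.
by rewrite agree // enc_sym_bits.
Qed.

End FiniteAlphabetMachine.

(** * Four-stack machines *)

Definition idx := (bool * bool)%type.
Definition quad (T : Type) := (T * T * T * T)%type.

Definition main : idx := (false, false).
Definition buffer : idx := (false, true).
Definition counter : idx := (true, false).
Definition spare : idx := (true, true).

Definition qget T (i : idx) (s : quad T) : T :=
  let: (a, b, c, d) := s in
  match i with
  | (false, false) => a | (false, true) => b
  | (true, false) => c | (true, true) => d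
  end.

Definition qset T (i : idx) (x : T) (s : quad T) : quad T :=
  let: (a, b, c, d) := s in
  match i with
  | (false, false) => (x, b, c, d) | (false, true) => (a, x, c, d)
  | (true, false) => (a, b, x, d) | (true, true) => (a, b, c, x)
  end.

Section Quads.

Variables (T : Type) (i j : idx).
Implicit Types (x y : T) (s : quad T).

Lemma qget_qset x s : qget i (qset j x s) = if i == j then x else qget i s.
Proof. by case: s => [[[a b] c] d]; case: i j => [[] []] [[] []]. Qed.

Lemma qget_qset_same x s : qget i (qset i x s) = x.
Proof. by case: s => [[[a b] c] d]; case: i => [[] []]. Qed.

Lemma qset_qset x y s : qset i x (qset i y s) = qset i x s.
Proof. by case: s => [[[a b] c] d]; case: i => [[] []]. Qed.

Lemma qset_id x s : qget i s = x -> qset i x s = s.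
Proof. by move<-; case: s => [[[a b] c] d]; case: i => [[] []]. Qed.

Lemma qsetC x y s : i != j -> qset i x (qset j y s) = qset j y (qset i x s).
Proof. by case: s => [[[a b] c] d]; case: i j => [[] []] [[] []]. Qed.

End Quads.

Definition stacks := quad (seq bool).

Definition height (s : stacks) : nat :=
  let: (a, b, c, d) := s in size a + size b + size c + size d.

Lemma size_qget_height i s : size (qget i s) <= height s.
Proof. by case: s => [[[a b] c] d]; case: i => [[] []] /=; lia. Qed.

Lemma height_qset i x s : height (qset i x s) + size (qget i s) = height s + size x.
Proof. by case: s => [[[a b] c] d]; case: i => [[] []] /=; lia. Qed.

Lemma height_push i b s : height (qset i (b :: qget i s) s) = (height s).+1.
Proof. by have := height_qset i (b :: qget i s) s; rewrite /=; lia. Qed.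

Lemma height_pop i b r s : qget i s = b :: r -> (height (qset i r s)).+1 = height s.
Proof. by move=> top; have := height_qset i r s; rewrite top /=; lia. Qed.

(* The numbers are the addresses at which execution continues. *)
Inductive instr :=
  | IPush of idx & bool & nat
  | IPop of idx & nat & nat & nat
  | INop of nat
  | IHalt of bool
  | IOut.

Definition continues (I : instr) : bool :=
  match I with IHalt _ | IOut => false | _ => true end.

Inductive phase (A : Type) :=
  | Start | Halted of bool | Scan of A | Take of A | Rewind of A | Emit.
Arguments Start {A}. Arguments Halted {A}. Arguments Emit {A}.

Section PhaseFinite.

Variable A : Type.

Definition phase_code (q : phase A) : option (option (bool + (A + (A + A)))) :=
  match q with
  | Start => None
  | Emit => Some None
  | Halted b => Some (Some (inl b))
  | Scan a => Some (Some (inr (inl a)))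
  | Take a => Some (Some (inr (inr (inl a))))
  | Rewind a => Some (Some (inr (inr (inr a))))
  end.

Definition phase_decode (x : option (option (bool + (A + (A + A))))) : phase A :=
  match x with
  | None => Start
  | Some None => Emit
  | Some (Some (inl b)) => Halted b
  | Some (Some (inr (inl a))) => Scan a
  | Some (Some (inr (inr (inl a)))) => Take a
  | Some (Some (inr (inr (inr a)))) => Rewind a
  end.

Lemma phase_codeK : cancel phase_code phase_decode. Proof. by case. Qed.

End PhaseFinite.

Lemma onth_rcons T (s : seq T) x j :
  onth (rcons s x) j = if j == size s then Some x else onth s j.
Proof. by elim: s j => [|y s IH] [|j] //=; case: j. Qed.

Section StackMachine.

Variable P : seq instr.

Let pc_t := 'I_(size P).+1.

Definition fetch (pc : pc_t) : instr := nth (IHalt false) P pc.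

Definition stack_conf := (pc_t * stacks)%type.

Definition istep (c : stack_conf) : stack_conf :=
  let: (pc, s) := c in
  match fetch pc with
  | IPush i b next => (inord next, qset i (b :: qget i s) s)
  | IPop i on_nil on_false on_true =>
      match qget i s with
      | [::] => (inord on_nil, s)
      | b :: r => (inord (if b then on_true else on_false), qset i r s)
      end
  | INop next => (inord next, s)
  | _ => c
  end.

Definition scanned (I : instr) : option idx :=
  match I with
  | IPush i _ _ | IPop i _ _ _ => Some i
  | IOut => Some main
  | _ => None
  end.

Lemma height_istep c : height (istep c).2 <= (height c.2).+1.
Proof.
case: c => pc s /=; case: (fetch pc) => [i b next|i a f t|next|b|] //=.
  by rewrite height_push.
by case top: (qget i s) => [|b r] //=; rewrite -(height_pop top); lia.
Qed.

(* A tape cell holds a mark, set exactly on cell 0, and one optional bit per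
   stack; the bottom of every stack lies in cell 0. *)
Definition cell := (bool * quad (option bool))%type.
Definition stack_sym := (option bool + cell)%type.

Definition cell_of (x : stack_sym) : cell :=
  match x with inl r => (false, (r, None, None, None)) | inr c => c end.

Definition is_origin (x : stack_sym) : bool := (cell_of x).1.
Definition track (i : idx) (x : stack_sym) : option bool := qget i (cell_of x).2.
Definition set_track (i : idx) (r : option bool) (x : stack_sym) : stack_sym :=
  inr (is_origin x, qset i r (cell_of x).2).

(* An instruction is executed from cell 0: [Scan] looks for the top of the stack
   concerned, [Take] pops it, and [Rewind] returns; [Emit] writes the output. *)
Definition phase_delta (q : phase pc_t) (x : stack_sym) : phase pc_t * stack_sym * move :=
  match q with
  | Start => (Scan (inord 0), inr (true, (cell_of x).2), MvS)
  | Halted b => (q, x, MvS)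
  | Scan pc =>
      match fetch pc with
      | IPush i b next =>
          if track i x is None then (Rewind (inord next), set_track i (Some b) x, MvS)
          else (q, x, MvR)
      | IPop i on_nil _ _ =>
          if track i x is None then
            if is_origin x then (Scan (inord on_nil), x, MvS) else (Take pc, x, MvL)
          else (q, x, MvR)
      | INop next => (Scan (inord next), x, MvS)
      | IHalt b => (Halted b, x, MvS)
      | IOut =>
          if track main x is None then
            if is_origin x then (Halted true, inl None, MvS) else (Emit, inl None, MvL)
          else (q, x, MvR)
      end
  | Take pc =>
      match fetch pc with
      | IPop i _ on_false on_true =>
          if track i x is Some b
          then (Rewind (inord (if b then on_true else on_false)), set_track i None x, MvS)
          else (q, x, MvS)
      | _ => (q, x, MvS)
      end
  | Rewind pc => if is_origin x then (Scan pc, x, MvS) else (Rewind pc, x, MvL)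
  | Emit => (if is_origin x then Halted true else Emit, inl (track main x), MvL)
  end.

Definition phase_fin : finType := can_type (@phase_codeK pc_t).

Definition stack_machine : TM :=
  @machine phase_fin cell phase_delta Start (Halted true) (Halted false).

Definition phase_step : tape_conf (phase pc_t) stack_sym -> tape_conf (phase pc_t) stack_sym :=
  @machine_step phase_fin cell phase_delta (Halted true) (Halted false).

Definition phase_init (w : seq bool) : tape_conf (phase pc_t) stack_sym :=
  @machine_init phase_fin cell Start w.

Lemma phase_stepE q h t : (if q is Halted _ then false else true) ->
  phase_step (q, h, t) =
  let: (q', x, m) := phase_delta q (t h) in (q', shift m h, write t h x).
Proof. by case: q. Qed.

Definition on_tape (s : stacks) (t : nat -> stack_sym) : Prop :=
  forall j, is_origin (t j) = (j == 0) /\ forall i, track i (t j) = onth (rev (qget i s)) j.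

Section OnTape.

Variables (s : stacks) (t : nat -> stack_sym).
Hypothesis st : on_tape s t.

Lemma on_tape_origin j : is_origin (t j) = (j == 0). Proof. by case: (st j). Qed.

Lemma on_tape_track i j : track i (t j) = onth (rev (qget i s)) j.
Proof. by case: (st j). Qed.

Lemma on_tape_occupied i j : track i (t j) = (j < size (qget i s)) :> bool.
Proof. by rewrite on_tape_track onthTE size_rev. Qed.

Lemma on_tape_top i : track i (t (size (qget i s))) = None.
Proof. by rewrite on_tape_track onth_default ?size_rev. Qed.

Lemma track_set_track i j r x : track i (set_track j r x) = if i == j then r else track i x.
Proof. exact: qget_qset. Qed.

Lemma on_tape_push i b (h := size (qget i s)) :
  on_tape (qset i (b :: qget i s) s) (write t h (set_track i (Some b) (t h))).
Proof.
move=> j; rewrite /write; split=> [|i'].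
  by case: eqP => [->|_]; apply: on_tape_origin.
rewrite qget_qset; case: (eqVneq j h) => [->|neq_jh].
  rewrite track_set_track on_tape_track; case: eqP => // _.
  by rewrite rev_cons onth_rcons size_rev eqxx.
rewrite on_tape_track; case: eqP => // ->.
by rewrite rev_cons onth_rcons size_rev (negbTE neq_jh).
Qed.

Lemma on_tape_pop i b r : qget i s = b :: r ->
  on_tape (qset i r s) (write t (size r) (set_track i None (t (size r)))).
Proof.
move=> top j; rewrite /write; split=> [|i'].
  by case: eqP => [->|_]; apply: on_tape_origin.
rewrite qget_qset; case: (eqVneq j (size r)) => [->|neq_jr].
  rewrite track_set_track on_tape_track; case: eqP => // _.
  by rewrite onth_default ?size_rev.
rewrite on_tape_track; case: eqP => // ->.
by rewrite top rev_cons onth_rcons size_rev (negbTE neq_jr).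
Qed.

Lemma scan_right pc i : scanned (fetch pc) = Some i ->
  iter (size (qget i s)) phase_step (Scan pc, 0, t) = (Scan pc, size (qget i s), t).
Proof.
move=> scan_i; have moves x : track i x -> phase_delta (Scan pc) x = (Scan pc, x, MvR).
  rewrite /=; case: (fetch pc) scan_i => //= [j b n|j e f u|] [->];
    by case: (track i x).
elim: {-2}(size _) (leqnn (size (qget i s))) => // h IH lt_h.
rewrite iterS IH ?(ltnW lt_h) // phase_stepE // moves ?on_tape_occupied //.
by rewrite write_same.
Qed.

Lemma rewind_left pc h : iter h.+1 phase_step (Rewind pc, h, t) = (Scan pc, 0, t).
Proof.
elim: h => [|h IH]; first by rewrite /= phase_stepE //= on_tape_origin /= write_same.
by rewrite iterSr phase_stepE //= on_tape_origin /= write_same.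
Qed.

End OnTape.

Definition simulated (bound : nat) (pc : pc_t) (t : nat -> stack_sym) (c : stack_conf) : Prop :=
  exists n t', [/\ n <= bound, iter n phase_step (Scan pc, 0, t) = (Scan c.1, 0, t')
                 & on_tape c.2 t'].

Section Simulation.

Variables (pc : pc_t) (s : stacks) (t : nat -> stack_sym).
Hypothesis st : on_tape s t.

Let bound := 2 * height s + 4.

Lemma simulate_push i b next : fetch pc = IPush i b next ->
  simulated bound pc t (inord next, qset i (b :: qget i s) s).
Proof.
move=> fetch_pc; pose h := size (qget i s); have le_h := size_qget_height i s.
have scan : iter h phase_step (Scan pc, 0, t) = (Scan pc, h, t).
  by apply: (scan_right st (i := i)); rewrite fetch_pc.
have pushed := on_tape_push st i b.
exists (h.+1 + (1 + h)), (write t h (set_track i (Some b) (t h))); split=> //.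
  by rewrite /bound -/h in le_h *; lia.
rewrite !iterD scan [iter 1 _ _]phase_stepE //= fetch_pc (on_tape_top st).
exact: rewind_left.
Qed.

Lemma simulate_pop_nil i on_nil on_false on_true :
    fetch pc = IPop i on_nil on_false on_true -> qget i s = [::] ->
  simulated bound pc t (inord on_nil, s).
Proof.
move=> fetch_pc top; exists 1, t; split=> //; first by rewrite /bound; lia.
by rewrite /= phase_stepE //= fetch_pc (on_tape_track st) top (on_tape_origin st) /= write_same.
Qed.

Lemma simulate_pop_cons i on_nil on_false on_true b r :
    fetch pc = IPop i on_nil on_false on_true -> qget i s = b :: r ->
  simulated bound pc t (inord (if b then on_true else on_false), qset i r s).
Proof.
move=> fetch_pc top; pose h := size (qget i s); have le_h := size_qget_height i s.
have hE : h = (size r).+1 by rewrite /h top.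
have scan : iter h phase_step (Scan pc, 0, t) = (Scan pc, h, t).
  by apply: (scan_right st (i := i)); rewrite fetch_pc.
have popped := on_tape_pop st top.
exists (h + (1 + (1 + h))), (write t (size r) (set_track i None (t (size r)))).
split=> //; first by rewrite /bound -/h in le_h *; lia.
rewrite !iterD scan [iter 1 _ (Scan _, _, _)]phase_stepE //= fetch_pc (on_tape_top st).
rewrite (on_tape_origin st) -/h hE /= write_same.
rewrite [phase_step (Take _, _, _)]phase_stepE //= fetch_pc.
by rewrite (on_tape_track st) top rev_cons onth_rcons size_rev eqxx -iterS (rewind_left popped).
Qed.

Lemma simulate_nop next : fetch pc = INop next -> simulated bound pc t (inord next, s).
Proof.
move=> fetch_pc; exists 1, t; split=> //; first by rewrite /bound; lia.
by rewrite /= phase_stepE //= fetch_pc /= write_same.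
Qed.

Lemma simulate_istep : continues (fetch pc) -> simulated bound pc t (istep (pc, s)).
Proof.
case fetch_pc: (fetch pc) => [i b next|i on_nil on_false on_true|next|b|] //= _.
- by rewrite fetch_pc; apply: simulate_push.
- rewrite fetch_pc; case top: (qget i s) => [|b r].
    exact: simulate_pop_nil fetch_pc top.
  exact: simulate_pop_cons fetch_pc top.
- by rewrite fetch_pc; apply: simulate_nop.
Qed.

Lemma simulate_halt b : fetch pc = IHalt b -> (phase_step (Scan pc, 0, t)).1.1 = Halted b.
Proof.
by move=> fetch_pc; rewrite phase_stepE //= fetch_pc.
Qed.

End Simulation.

Inductive reaches : nat -> stack_conf -> stack_conf -> Prop :=
  | reaches_refl n c : reaches n c c
  | reaches_step n c c' :
      continues (fetch c.1) -> reaches n (istep c) c' -> reaches n.+1 c c'.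

Lemma reaches_leq m n c c' : m <= n -> reaches m c c' -> reaches n c c'.
Proof.
move=> + run; elim: run n => {m c c'} [m c|m c c' ctl _ IH] [|n] //; try by constructor.
by move=> /IH; apply: reaches_step.
Qed.

Lemma reaches_trans m n c1 c2 c3 :
  reaches m c1 c2 -> reaches n c2 c3 -> reaches (m + n) c1 c3.
Proof.
elim=> {m c1 c2} [m c|m c c' ctl _ IH] run; first exact: reaches_leq (leq_addl _ _) run.
by apply: reaches_step ctl (IH run).
Qed.

Lemma simulate_reaches n c c' t : reaches n c c' -> on_tape c.2 t ->
  simulated (n * (2 * (height c.2 + n) + 4)) c.1 t c'.
Proof.
move=> run; elim: run t => {n c c'} [n c|n c c' ctl _ IH] t st; first by exists 0, t.
have [m [t' [le_m run_m st']]] := simulate_istep st ctl.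
have le_height := height_istep c; rewrite -surjective_pairing in run_m st' *.
have [k [t'' [le_k run_k st'']]] := IH _ st'.
by exists (k + m), t''; split; rewrite ?iterD ?run_m //; nia.
Qed.

Definition entry (w : seq bool) : stacks := (rev w, [::], [::], [::]).

Lemma height_entry w : height (entry w) = size w.
Proof. by rewrite /= size_rev !addn0. Qed.

Lemma simulate_start w : exists2 t,
  phase_step (phase_init w) = (Scan (inord 0), 0, t) & on_tape (entry w) t.
Proof.
exists (write (fun j => inl (onth w j)) 0 (inr (true, (onth w 0, None, None, None)))).
  by rewrite phase_stepE.
move=> j; rewrite /write; case: eqP => [->|_] /=; split=> //;
  by case=> [[] []] //=; rewrite ?revK ?onth0n.
Qed.

Lemma emit_left t h :
    (forall j, is_origin (t j) = (j == 0)) ->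
  iter h.+1 phase_step (Emit, h, t) =
    (Halted true, 0, fun j => if j <= h then inl (track main (t j)) else t j).
Proof.
elim: h t => [|h IH] t origin.
  rewrite /= phase_stepE //= origin; congr (_, _).
  by apply: functional_extensionality => j; rewrite /write leqn0; case: eqP => // ->.
rewrite iterSr phase_stepE //= origin -iterS IH => [|j]; last first.
  by rewrite /write; case: eqP => [->|].
congr (_, _); apply: functional_extensionality => j; rewrite /write.
case: (ltngtP j h.+1) => [lt_jh|lt_hj|->].
- by rewrite -ltnS lt_jh.
- by rewrite leqNgt (ltnW lt_hj).
- by rewrite ltnn.
Qed.

Lemma simulate_out pc t s : fetch pc = IOut -> on_tape s t ->
  exists n t', [/\ n <= 2 * height s + 4,
    iter n phase_step (Scan pc, 0, t) = (Halted true, 0, t')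
    & forall j, j <= size (qget main s) -> t' j = inl (onth (rev (qget main s)) j)].
Proof.
move=> fetch_pc st; pose h := size (qget main s); have le_h := size_qget_height main s.
have scan : iter h phase_step (Scan pc, 0, t) = (Scan pc, h, t).
  by apply: (scan_right st (i := main)); rewrite fetch_pc.
have top : track main (t h) = None := on_tape_top st main.
pose erased := write t h (inl None : stack_sym).
have erased_track j : j <= h -> track main (erased j) = onth (rev (qget main s)) j.
  rewrite /erased /write; case: eqP => [->|_] _; last exact: on_tape_track.
  by rewrite onth_default ?size_rev.
case: (posnP h) => [h0|h_gt0].
  exists 1, erased; split; first by lia.
    by rewrite /= phase_stepE //= fetch_pc /erased -h0 top h0 (on_tape_origin st).
  move=> j le_j; rewrite -erased_track // /erased /write.
  by move: le_j; rewrite -/h h0 leqn0 => ->.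
have erased_origin j : is_origin (erased j) = (j == 0).
  rewrite /erased /write; case: eqP => [->|_]; last exact: on_tape_origin.
  by rewrite gtn_eqF.
exists (h + (1 + h)), (fun j => if j <= h.-1 then inl (track main (erased j)) else erased j).
split; first by rewrite -/h in le_h; lia.
  rewrite !iterD scan [iter 1 _ _]phase_stepE //= fetch_pc top (on_tape_origin st).
  by rewrite gtn_eqF // -{1}(prednK h_gt0) emit_left.
move=> j le_j; rewrite -erased_track //; case: ltnP => // lt_hj.
by rewrite /erased /write (_ : j = h) ?eqxx //; lia.
Qed.

Lemma simulate_program w n c : reaches n (inord 0, entry w) c ->
  exists m t, [/\ m <= 1 + n * (2 * (size w + n) + 4),
    iter m phase_step (phase_init w) = (Scan c.1, 0, t) & on_tape c.2 t].
Proof.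
move=> run; have [t start st] := simulate_start w.
have [m [t' [le_m run_m st']]] := simulate_reaches run st.
exists (m + 1), t'; split=> //; last by rewrite iterD /= start.
by move: le_m; rewrite height_entry; lia.
Qed.

Lemma stack_machine_halts w b m n :
    (iter m phase_step (phase_init w)).1.1 = Halted b -> m <= n ->
  let c := run n (init stack_machine w) in
  halted c /\ (c.1 == tm_acc stack_machine) = b.
Proof.
move=> halt_b le_mn /=; rewrite machine_halted machine_accepts.
by rewrite (iter_tape_step_stable _ le_mn) halt_b; case: b {halt_b}.
Qed.

Lemma stack_machine_outputs w u t m n :
    iter m phase_step (phase_init w) = (Halted true, 0, t) ->
    (forall j, j <= size u -> t j = inl (onth u j)) -> m <= n ->
  let c := run n (init stack_machine w) in halted c /\ output c = u.
Proof.
move=> halt_m out le_mn /=.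
have halt_n : iter n phase_step (phase_init w) = (Halted true, 0, t).
  by rewrite -halt_m; apply: iter_tape_step_stable; rewrite ?halt_m.
split; first by rewrite machine_halted halt_n.
by apply: machine_output; rewrite halt_n.
Qed.

End StackMachine.

(** * Polynomial bounds *)

Definition poly_bounded (p : nat -> nat) : Prop := exists k, forall n, p n <= n.+2 ^ k.

Lemma leq_expn2r k m n : m <= n -> m ^ k <= n ^ k.
Proof. by case: k => // k le_mn; rewrite leq_exp2r. Qed.

Lemma poly_bounded_leq p q : (forall n, p n <= q n) -> poly_bounded q -> poly_bounded p.
Proof. by move=> le_pq [k le_q]; exists k => n; apply: leq_trans (le_pq n) (le_q n). Qed.

Lemma poly_bounded_cst c : poly_bounded (fun=> c).
Proof.
by exists c => n; apply: leq_trans (ltnW (ltn_expl c (ltnSn 1))) (leq_expn2r _ _).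
Qed.

Lemma poly_bounded_id : poly_bounded (fun n => n).
Proof. by exists 1 => n; rewrite expn1; lia. Qed.

Lemma poly_bounded_add p q :
  poly_bounded p -> poly_bounded q -> poly_bounded (fun n => p n + q n).
Proof.
move=> [k le_p] [l le_q]; exists (maxn k l).+1 => n; rewrite expnS.
have : n.+2 ^ k <= n.+2 ^ maxn k l by rewrite leq_exp2l // leq_maxl.
have : n.+2 ^ l <= n.+2 ^ maxn k l by rewrite leq_exp2l // leq_maxr.
by have := le_p n; have := le_q n; nia.
Qed.

Lemma poly_bounded_succ p : poly_bounded p -> poly_bounded (fun n => (p n).+1).
Proof.
move=> bp; apply: poly_bounded_leq (poly_bounded_add bp (poly_bounded_cst 1)) => n.
by rewrite addn1.
Qed.

Lemma poly_bounded_mul p q :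
  poly_bounded p -> poly_bounded q -> poly_bounded (fun n => p n * q n).
Proof. by move=> [k le_p] [l le_q]; exists (k + l) => n; rewrite expnD leq_mul. Qed.

Lemma poly_bounded_exp k p : poly_bounded p -> poly_bounded (fun n => p n ^ k).
Proof.
move=> bp; elim: k => [|k IH]; first exact: (poly_bounded_cst 1).
by apply: poly_bounded_leq (poly_bounded_mul bp IH) => n; rewrite expnS.
Qed.

Create HintDb poly_bounded.
#[export] Hint Resolve poly_bounded_cst poly_bounded_id poly_bounded_add poly_bounded_succ
  poly_bounded_mul poly_bounded_exp : poly_bounded.

Ltac poly_bounded := by auto 50 with poly_bounded.

Lemma poly_bounded_poly_bound p :
  poly_bounded p -> exists K, forall n, p n <= poly_bound K n.
Proof.
case=> k le_p; exists (3 ^ k + k) => n; apply: leq_trans (le_p n) _; rewrite /poly_bound.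
have le_base : 2 ^ k <= 3 ^ k := leq_expn2r k (leqnSn 2).
case: n => [|n]; first by lia.
have split_base : n.+3 ^ k <= 3 ^ k * n.+1 ^ k by rewrite -expnMn leq_expn2r //; lia.
have : n.+1 ^ k <= n.+1 ^ (3 ^ k + k) by rewrite leq_pexp2l // leq_addl.
by nia.
Qed.

(** * Structured stack programs *)

Inductive cmd :=
  | Skip
  | Push of idx & bool
  | Seq of cmd & cmd
  | Case of idx & cmd & cmd
  | Each of idx & cmd & cmd
  | While of idx & cmd.

Inductive runs : cmd -> stacks -> nat -> stacks -> Prop :=
  | runs_skip s : runs Skip s 1 s
  | runs_push i b s : runs (Push i b) s 1 (qset i (b :: qget i s) s)
  | runs_seq c1 c2 s1 n1 s2 n2 s3 :
      runs c1 s1 n1 s2 -> runs c2 s2 n2 s3 -> runs (Seq c1 c2) s1 (n1 + n2) s3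
  | runs_case i cf ct s b r n s' :
      qget i s = b :: r -> runs (if b then ct else cf) (qset i r s) n s' ->
      runs (Case i cf ct) s n.+1 s'
  | runs_each_nil i cf ct s : qget i s = [::] -> runs (Each i cf ct) s 1 s
  | runs_each_cons i cf ct s b r n1 s1 n2 s2 :
      qget i s = b :: r -> runs (if b then ct else cf) (qset i r s) n1 s1 ->
      runs (Each i cf ct) s1 n2 s2 -> runs (Each i cf ct) s (1 + (n1 + n2)) s2
  | runs_while_false i c s r : qget i s = false :: r -> runs (While i c) s 1 (qset i r s)
  | runs_while_true i c s r n1 s1 n2 s2 :
      qget i s = true :: r -> runs c (qset i r s) n1 s1 ->
      runs (While i c) s1 n2 s2 -> runs (While i c) s (1 + (n1 + n2)) s2
  | runs_leq c s m n s' : runs c s m s' -> m <= n -> runs c s n s'.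

Lemma runs_height c s n s' : runs c s n s' -> height s' <= height s + n.
Proof.
elim=> {c s n s'}; try lia.
- by move=> i b s; rewrite height_push addn1.
- by move=> i cf ct s b r n s' /height_pop; lia.
- by move=> i cf ct s b r n1 s1 n2 s2 /height_pop; lia.
- by move=> i c s r /height_pop; lia.
- by move=> i c s r n1 s1 n2 s2 /height_pop; lia.
Qed.

Fixpoint code_size (c : cmd) : nat :=
  match c with
  | Skip | Push _ _ => 1
  | Seq c1 c2 => code_size c1 + code_size c2
  | Case _ cf ct | Each _ cf ct => (code_size cf + code_size ct).+1
  | While _ c => (code_size c).+1
  end.

Fixpoint compile (c : cmd) (pc next : nat) : seq instr :=
  match c with
  | Skip => [:: INop next]
  | Push i b => [:: IPush i b next]
  | Seq c1 c2 => let pc2 := pc + code_size c1 in compile c1 pc pc2 ++ compile c2 pc2 next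
  | Case i cf ct =>
      let pct := pc.+1 + code_size cf in
      IPop i next pc.+1 pct :: compile cf pc.+1 next ++ compile ct pct next
  | Each i cf ct =>
      let pct := pc.+1 + code_size cf in
      IPop i next pc.+1 pct :: compile cf pc.+1 pc ++ compile ct pct pc
  | While i c => IPop i next next pc.+1 :: compile c pc.+1 pc
  end.

Lemma size_compile c pc next : size (compile c pc next) = code_size c.
Proof.
elim: c pc next => //= [c1 IH1 c2 IH2|i cf IHf ct IHt|i cf IHf ct IHt|i c IH] pc next;
  by rewrite ?size_cat ?IH1 ?IH2 ?IHf ?IHt ?IH.
Qed.

Section CompilerCorrectness.

Variable P : seq instr.

Definition code_at (pc : nat) (C : seq instr) : Prop :=
  exists pre post, P = pre ++ C ++ post /\ size pre = pc.

Lemma code_at_catl pc C1 C2 : code_at pc (C1 ++ C2) -> code_at pc C1.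
Proof. by move=> [pre [post [def_P <-]]]; exists pre, (C2 ++ post); rewrite def_P -catA. Qed.

Lemma code_at_catr pc C1 C2 : code_at pc (C1 ++ C2) -> code_at (pc + size C1) C2.
Proof.
by move=> [pre [post [def_P <-]]]; exists (pre ++ C1), post; rewrite size_cat def_P !catA.
Qed.

Lemma code_at_behead pc I C : code_at pc (I :: C) -> code_at pc.+1 C.
Proof. by move=> /(@code_at_catr _ [:: I]); rewrite addn1. Qed.

Lemma fetch_code_at pc I C : code_at pc (I :: C) -> @fetch P (inord pc) = I.
Proof.
move=> [pre [post [def_P <-]]]; rewrite /fetch inordK.
  by rewrite def_P nth_cat ltnn subnn.
by rewrite def_P !size_cat /=; lia.
Qed.

Lemma code_at_branch pc c1 c2 next (b : bool) :
    code_at pc (compile c1 pc next ++ compile c2 (pc + code_size c1) next) ->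
  code_at (if b then pc + code_size c1 else pc)
          (compile (if b then c2 else c1) (if b then pc + code_size c1 else pc) next).
Proof. by case: b => [/code_at_catr|/code_at_catl //]; rewrite size_compile. Qed.

Lemma compile_correct c s n s' : runs c s n s' -> forall pc next,
  code_at pc (compile c pc next) -> reaches n (inord pc : 'I_(size P).+1, s) (inord next, s').
Proof.
elim=> {c s n s'} /=.
- move=> s pc next /fetch_code_at fetch_pc.
  by apply: reaches_step; rewrite /= fetch_pc //; apply: reaches_refl.
- move=> i b s pc next /fetch_code_at fetch_pc.
  by apply: reaches_step; rewrite /= fetch_pc //; apply: reaches_refl.
- move=> c1 c2 s1 n1 s2 n2 s3 _ IH1 _ IH2 pc next at_pc.
  apply: reaches_trans (IH1 _ _ (code_at_catl at_pc)) (IH2 _ _ _).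
  by have := code_at_catr at_pc; rewrite size_compile.
- move=> i cf ct s b r n s' top _ IH pc next at_pc.
  apply: reaches_step; rewrite /= (fetch_code_at at_pc) //= top.
  exact: IH (code_at_branch _ (code_at_behead at_pc)).
- move=> i cf ct s top pc next at_pc.
  by apply: reaches_step; rewrite /= (fetch_code_at at_pc) //= top; apply: reaches_refl.
- move=> i cf ct s b r n1 s1 n2 s2 top _ IH1 _ IH2 pc next at_pc.
  apply: reaches_step; rewrite /= (fetch_code_at at_pc) //= top.
  apply: reaches_trans (IH2 _ _ at_pc).
  exact: IH1 (code_at_branch _ (code_at_behead at_pc)).
- move=> i c s r top pc next at_pc.
  by apply: reaches_step; rewrite /= (fetch_code_at at_pc) //= top; apply: reaches_refl.
- move=> i c s r n1 s1 n2 s2 top _ IH1 _ IH2 pc next at_pc.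
  apply: reaches_step; rewrite /= (fetch_code_at at_pc) //= top.
  exact: reaches_trans (IH1 _ _ (code_at_behead at_pc)) (IH2 _ _ at_pc).
- move=> c s m n s' _ IH le_mn pc next at_pc; exact: reaches_leq le_mn (IH _ _ at_pc).
Qed.

End CompilerCorrectness.

Lemma decider_in_P c (f : seq bool -> bool) p : poly_bounded p ->
    (forall w, exists s r, runs c (entry w) (p (size w)) s /\ qget main s = f w :: r) ->
  in_P (fun w => f w).
Proof.
move=> bp decides; pose L := code_size c.
pose test := [:: IPop main L.+1 L.+1 L.+2; IHalt false; IHalt true].
pose P := compile c 0 L ++ test.
have at_c : code_at P 0 (compile c 0 L) by exists [::], test.
have at_test : code_at P L test by exists (compile c 0 L), [::]; rewrite cats0 size_compile.
have at_false := code_at_behead at_test; have at_true := code_at_behead at_false.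
have [K le_K] : exists K, forall n,
    2 + (p n + 1) * (2 * (n + (p n + 1)) + 4) <= poly_bound K n.
  by apply: poly_bounded_poly_bound; poly_bounded.
exists (stack_machine P), K => w; have [s [r [run_c answer]]] := decides w.
have run_test : reaches 1 (inord L : 'I_(size P).+1, s)
    (inord (if f w then L.+2 else L.+1), qset main r s).
  apply: reaches_step; rewrite /= (fetch_code_at at_test) //= answer.
  exact: reaches_refl.
have run := reaches_trans (compile_correct run_c at_c) run_test.
have [m [t [le_m run_m _]]] := simulate_program run.
have halt_pc : @fetch P (inord (if f w then L.+2 else L.+1)) = IHalt (f w).
  by case: (f w); [apply: fetch_code_at at_true | apply: fetch_code_at at_false].
have halt : (iter (1 + m) (@phase_step P) (phase_init P w)).1.1 = Halted (f w).
  by rewrite iterD run_m; apply: simulate_halt.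
have [|halted_w accepts] := stack_machine_halts halt (n := poly_bound K (size w)).
  by apply: leq_trans (le_K _); lia.
by split; rewrite ?accepts.
Qed.

Lemma transducer_in_FP c (f : seq bool -> seq bool) p : poly_bounded p ->
    (forall w, exists2 s, runs c (entry w) (p (size w)) s & qget main s = rev (f w)) ->
  in_FP f.
Proof.
move=> bp computes; pose L := code_size c; pose P := compile c 0 L ++ [:: IOut].
have at_c : code_at P 0 (compile c 0 L) by exists [::], [:: IOut].
have at_out : code_at P L [:: IOut] by exists (compile c 0 L), [::]; rewrite cats0 size_compile.
have [K le_K] : exists K, forall n,
    1 + p n * (2 * (n + p n) + 4) + (2 * (n + p n) + 4) <= poly_bound K n.
  by apply: poly_bounded_poly_bound; poly_bounded.
exists (stack_machine P), K => w; have [s run_c result] := computes w.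
have [m [t [le_m run_m st]]] := simulate_program (compile_correct run_c at_c).
have [k [t' [le_k run_k out]]] := simulate_out (s := s) (fetch_code_at at_out) st.
apply: (@stack_machine_outputs P w (f w) t' (k + m)).
- by rewrite iterD run_m.
- by move=> j le_j; rewrite out result ?revK ?size_rev.
- apply: leq_trans (le_K (size w)).
  by have := runs_height run_c; rewrite height_entry; lia.
Qed.

Lemma runs_push_if i b s :
  runs (if b then Push i true else Push i false) s 1 (qset i (b :: qget i s) s).
Proof. by case: b; constructor. Qed.

Definition pushes (i : idx) (u : seq bool) : cmd :=
  foldr (fun b c => Seq c (Push i b)) Skip u.

Lemma runs_pushes i u s : runs (pushes i u) s (size u).+1 (qset i (u ++ qget i s) s).
Proof.
elim: u => [|b u IH] /=; first by rewrite qset_id //; apply: runs_skip.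
rewrite -[(size u).+2]addn1; apply: runs_seq IH _.
by have := runs_push i b (qset i (u ++ qget i s) s); rewrite qget_qset_same qset_qset.
Qed.

Definition pop (i : idx) : cmd := Case i Skip Skip.

Lemma runs_pop i b r s : qget i s = b :: r -> runs (pop i) s 2 (qset i r s).
Proof. by move=> top; apply: runs_case top _; case: b; apply: runs_skip. Qed.

Definition clear (i : idx) : cmd := Each i Skip Skip.

Lemma runs_clear i s : runs (clear i) s (2 * size (qget i s) + 1) (qset i [::] s).
Proof.
move: {-1}(qget i s) (erefl (qget i s)) => x; elim: x s => [|b x IH] s top.
  by rewrite (qset_id top); apply: runs_each_nil.
have skip : runs (if b then Skip else Skip) (qset i x s) 1 (qset i x s).
  by case: b {top}; apply: runs_skip.
have := runs_each_cons top skip (IH _ (qget_qset_same _ _ _)).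
by rewrite qset_qset => run; apply: runs_leq run _; rewrite /=; lia.
Qed.

Definition transfer (i j : idx) : cmd := Each i (Push j false) (Push j true).

Lemma runs_transfer i j s : i != j ->
  runs (transfer i j) s (2 * size (qget i s) + 1)
       (qset j (catrev (qget i s) (qget j s)) (qset i [::] s)).
Proof.
move=> neq_ij; move: {-1}(qget i s) (erefl (qget i s)) => x.
elim: x s => [|b x IH] s top.
  by rewrite (qset_id top) /= qset_id //; apply: runs_each_nil.
have neq_ji : j != i by rewrite eq_sym.
pose s' := qset j (b :: qget j s) (qset i x s).
have push_b : runs (if b then Push j true else Push j false) (qset i x s) 1 s'.
  by have := runs_push_if j b (qset i x s); rewrite qget_qset (negbTE neq_ji).
have top' : qget i s' = x by rewrite qget_qset (negbTE neq_ij) qget_qset_same.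
have := runs_each_cons top push_b (IH _ top').
rewrite qget_qset_same (qsetC _ _ _ neq_ij) !qset_qset => run.
by apply: runs_leq run _; rewrite /=; lia.
Qed.

Lemma runs_transfer_rev i j x s : i != j -> qget i s = rev x ->
  runs (transfer i j) s (2 * size x + 1) (qset j (x ++ qget j s) (qset i [::] s)).
Proof.
by move=> neq_ij top; have := runs_transfer s neq_ij; rewrite top catrevE revK size_rev.
Qed.

(** * Binary trees on a stack *)

Inductive tree := Leaf | Node of tree & tree.

Fixpoint prefix_code (t : tree) : seq bool :=
  if t is Node a b then true :: prefix_code a ++ prefix_code b else [:: false].

Lemma prefix_code_cat_inj t1 t2 r1 r2 :
  prefix_code t1 ++ r1 = prefix_code t2 ++ r2 -> t1 = t2 /\ r1 = r2.
Proof.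
elim: t1 t2 r1 r2 => [|a1 IHa b1 IHb] [|a2 b2] r1 r2 //=; first by case.
by case; rewrite -!catA => /IHa[-> /IHb[-> ->]].
Qed.

Lemma prefix_code_inj : injective prefix_code.
Proof.
by move=> t1 t2 eq_code; case: (@prefix_code_cat_inj t1 t2 [::] [::]); rewrite ?cats0.
Qed.

Lemma size_prefix_code_gt0 t : 0 < size (prefix_code t).
Proof. by case: t. Qed.

Definition operands (u : seq bool) : stacks := (u, [::], [::], [::]).

Lemma runs_pop_operands b u : runs (pop main) (operands (b :: u)) 2 (operands u).
Proof. exact: (runs_pop (b := b)). Qed.

(* The counter holds, in unary, the number of subtrees still to be moved. *)
Definition move_node : cmd :=
  Case main (Push buffer false)
    (Seq (Push buffer true) (Seq (Push counter true) (Push counter true))).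

Definition move_subtrees : cmd := Each counter Skip move_node.

Definition move_tree : cmd := Seq (Push counter true) move_subtrees.

Lemma runs_move_subtrees t u x z m n s :
    runs move_subtrees (u, catrev (prefix_code t) x, nseq m true, z) n s ->
  runs move_subtrees (prefix_code t ++ u, x, nseq m.+1 true, z)
    (5 * size (prefix_code t) + n) s.
Proof.
pose S v y k : stacks := (v, y, nseq k true, z).
have pop_counter v y k : qget counter (S v y k.+1) = true :: nseq k true by [].
elim: t u x m n => [|a IHa b IHb] u x m n rest.
  have leaf : runs move_node (S (false :: u) x m) 2 (S u (false :: x) m).
    apply: (runs_case (b := false) (r := u)) => //.
    exact: runs_push.
  by apply: runs_leq (runs_each_cons (pop_counter (false :: u) x m) leaf rest) _;
    rewrite /=; lia.
rewrite /= catrev_catl in rest.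
pose v := prefix_code a ++ prefix_code b ++ u.
have node : runs move_node (S (true :: v) x m) 4 (S v (true :: x) m.+2).
  apply: (runs_case (b := true) (r := v)) => //.
  exact: runs_seq (runs_push _ _ _) (runs_seq (runs_push _ _ _) (runs_push _ _ _)).
have {}rest := IHa _ _ _ _ (IHb _ _ _ _ rest).
rewrite /= -catA; apply: runs_leq (runs_each_cons (pop_counter (true :: v) x m) node rest) _.
by rewrite size_cat; lia.
Qed.

Lemma runs_move_tree t u z :
  runs move_tree (prefix_code t ++ u, [::], [::], z) (5 * size (prefix_code t) + 2)
       (u, rev (prefix_code t), [::], z).
Proof.
have finish : runs move_subtrees (u, catrev (prefix_code t) [::], nseq 0 true, z) 1
                   (u, rev (prefix_code t), [::], z) by apply: runs_each_nil.
have start := runs_push counter true (prefix_code t ++ u, [::], [::], z).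
by apply: runs_leq (runs_seq start (runs_move_subtrees finish)) _; lia.
Qed.

Definition drop_tree : cmd := Seq move_tree (clear buffer).

Lemma runs_drop_tree t u :
  runs drop_tree (operands (prefix_code t ++ u)) (7 * size (prefix_code t) + 3) (operands u).
Proof.
apply: runs_leq (runs_seq (runs_move_tree t u [::]) (runs_clear buffer _)) _.
by rewrite size_rev; lia.
Qed.

Definition fan_out : cmd :=
  Each buffer (Seq (Push main false) (Push spare false))
              (Seq (Push main true) (Push spare true)).

Lemma runs_fan_out x u y z :
  runs fan_out (u, x, y, z) (3 * size x + 1) (catrev x u, [::], y, catrev x z).
Proof.
elim: x u z => [|b x IH] u z; first exact: runs_each_nil.
have push_both : runs (if b then Seq (Push main true) (Push spare true)
                       else Seq (Push main false) (Push spare false))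
                      (u, x, y, z) 2 (b :: u, x, y, b :: z).
  by case: b; apply: runs_seq (runs_push _ _ _) (runs_push _ _ _).
have top : qget buffer (u, b :: x, y, z) = b :: x by [].
by apply: runs_leq (runs_each_cons top push_both (IH _ _)) _; rewrite /=; lia.
Qed.

Definition dup_tree : cmd :=
  Seq move_tree (Seq fan_out (Seq (transfer spare buffer) (transfer buffer main))).

Lemma runs_dup_tree t u :
  runs dup_tree (operands (prefix_code t ++ u)) (12 * size (prefix_code t) + 5)
       (operands (prefix_code t ++ prefix_code t ++ u)).
Proof.
set x := prefix_code t; have move_t : runs _ _ _ _ := runs_move_tree t u [::].
have copy_t := runs_fan_out (rev x) u [::] [::].
rewrite catrevE revK -/(rev (rev x)) revK in copy_t.
have move_copy := @runs_transfer spare buffer (x ++ u, [::], [::], x) isT.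
have restore := @runs_transfer_rev buffer main x (x ++ u, rev x, [::], [::]) isT erefl.
apply: runs_leq (runs_seq move_t (runs_seq copy_t (runs_seq move_copy restore))) _.
by rewrite size_rev /= -/x; lia.
Qed.

Definition swap_trees : cmd :=
  Seq move_tree (Seq (transfer buffer spare) (Seq move_tree
    (Seq (transfer spare counter) (Seq (transfer counter main) (transfer buffer main))))).

Lemma runs_swap_trees t1 t2 u :
  runs swap_trees (operands (prefix_code t1 ++ prefix_code t2 ++ u))
    (11 * (size (prefix_code t1) + size (prefix_code t2)) + 8)
    (operands (prefix_code t2 ++ prefix_code t1 ++ u)).
Proof.
set x := prefix_code t1; set y := prefix_code t2.
have move_t1 : runs _ _ _ _ := runs_move_tree t1 (y ++ u) [::].
have save_t1 := @runs_transfer_rev buffer spare x (y ++ u, rev x, [::], [::]) isT erefl.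
rewrite /= cats0 in save_t1.
have move_t2 : runs _ _ _ _ := runs_move_tree t2 u x.
have reverse_t1 := @runs_transfer spare counter (u, rev y, [::], x) isT.
have restore_t1 := @runs_transfer_rev counter main x (u, rev y, rev x, [::]) isT erefl.
have restore_t2 := @runs_transfer_rev buffer main y (x ++ u, rev y, [::], [::]) isT erefl.
apply: runs_leq (runs_seq move_t1 (runs_seq save_t1 (runs_seq move_t2
  (runs_seq reverse_t1 (runs_seq restore_t1 restore_t2))))) _.
by rewrite /= -/x -/y; lia.
Qed.

(** * Polynomial-time functions on encoded data *)

HB.mixin Record isEncodable A of Equality A := { enc : A -> tree; enc_inj : injective enc }.

#[short(type="encType")]
HB.structure Definition Encodable := { A of isEncodable A & Equality A }.

Definition enc_bool (b : bool) : tree := if b then Node Leaf Leaf else Leaf.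

Lemma enc_bool_inj : injective enc_bool. Proof. by case; case. Qed.

HB.instance Definition _ := isEncodable.Build bool enc_bool_inj.

Fixpoint enc_nat (n : nat) : tree := if n is n'.+1 then Node Leaf (enc_nat n') else Leaf.

Lemma enc_nat_inj : injective enc_nat.
Proof. by elim=> [|n IH] [|m] //= [/IH ->]. Qed.

HB.instance Definition _ := isEncodable.Build nat enc_nat_inj.

Definition enc_ord n (i : 'I_n) : tree := enc_nat i.

Lemma enc_ord_inj n : injective (@enc_ord n).
Proof. exact: inj_comp enc_nat_inj val_inj. Qed.

HB.instance Definition _ n := isEncodable.Build 'I_n (@enc_ord_inj n).

Section Encodings.

Variables A B : encType.

Definition enc_option (x : option A) : tree := if x is Some a then Node Leaf (enc a) else Leaf.

Lemma enc_option_inj : injective enc_option.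
Proof. by move=> [a|] [b|] //= [/enc_inj->]. Qed.

HB.instance Definition _ := isEncodable.Build (option A) enc_option_inj.

Definition enc_prod (p : A * B) : tree := Node (enc p.1) (enc p.2).

Lemma enc_prod_inj : injective enc_prod.
Proof. by move=> [a b] [a' b'] [] /= /enc_inj-> /enc_inj->. Qed.

HB.instance Definition _ := isEncodable.Build (A * B)%type enc_prod_inj.

Definition enc_sum (x : A + B) : tree :=
  match x with inl a => Node Leaf (enc a) | inr b => Node (Node Leaf Leaf) (enc b) end.

Lemma enc_sum_inj : injective enc_sum.
Proof. by move=> [a|b] [a'|b'] //= [] /enc_inj->. Qed.

HB.instance Definition _ := isEncodable.Build (A + B)%type enc_sum_inj.

Fixpoint enc_seq (s : seq A) : tree :=
  if s is x :: s' then Node (enc x) (enc_seq s') else Leaf.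

Lemma enc_seq_inj : injective enc_seq.
Proof. by elim=> [|x s IH] [|y s'] //= [] /enc_inj-> /IH->. Qed.

HB.instance Definition _ := isEncodable.Build (seq A) enc_seq_inj.

End Encodings.

Definition bits (A : encType) (a : A) : seq bool := prefix_code (enc a).

Definition esize (A : encType) (a : A) : nat := size (bits a).

Lemma bits_inj (A : encType) : injective (@bits A).
Proof. exact: inj_comp prefix_code_inj enc_inj. Qed.

Section EncodedSize.

Variables A B : encType.
Implicit Types (a : A) (b : B) (s : seq A).

Lemma bits_pair a b : bits (a, b) = true :: bits a ++ bits b. Proof. by []. Qed.

Lemma bits_cons a s : bits (a :: s) = true :: bits a ++ bits s. Proof. by []. Qed.

Lemma esize_pair a b : esize (a, b) = (esize a + esize b).+1.
Proof. by rewrite /esize bits_pair /= size_cat. Qed.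

Lemma esize_cons a s : esize (a :: s) = (esize a + esize s).+1.
Proof. by rewrite /esize bits_cons /= size_cat. Qed.

Lemma esize_nil : esize ([::] : seq A) = 1. Proof. by []. Qed.

Lemma esize_gt0 a : 0 < esize a. Proof. exact: size_prefix_code_gt0. Qed.

End EncodedSize.

Section EncodedSeqSize.

Variable A : encType.
Implicit Types s t : seq A.

Lemma esize_cat s t : (esize (s ++ t)).+1 = esize s + esize t.
Proof. by elim: s => [|a s IH] //=; rewrite !esize_cons; lia. Qed.

Lemma esize_catl s t : esize s <= esize (s ++ t).
Proof. by have := esize_cat s t; have := esize_gt0 t; lia. Qed.

Lemma size_esize s : size s < esize s.
Proof. by elim: s => [|a s IH] //=; rewrite esize_cons; lia. Qed.

End EncodedSeqSize.

Lemma bits_succ n : bits n.+1 = [:: true, false & bits n]. Proof. by []. Qed.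

Lemma esize_nat n : esize n = (2 * n).+1.
Proof. by elim: n => // n IH; rewrite /esize bits_succ /= -/(esize n) IH; lia. Qed.

Lemma esize_bool (b : bool) : esize b <= 3. Proof. by case: b. Qed.

Lemma esize_bits (w : seq bool) : esize w <= 4 * size w + 1.
Proof. by elim: w => [|b w IH] //=; rewrite esize_cons; have := esize_bool b; lia. Qed.

Section PolynomialTime.

Variables A B : encType.

Definition polytime (f : A -> B) : Prop :=
  exists c k, forall a u,
    runs c (operands (bits a ++ u)) ((esize a).+2 ^ k) (operands (bits (f a) ++ u)).

Lemma polytime_intro c p f :
    poly_bounded p ->
    (forall a u, runs c (operands (bits a ++ u)) (p (esize a)) (operands (bits (f a) ++ u))) ->
  polytime f.
Proof. by move=> [k le_p] run_c; exists c, k => a u; apply: runs_leq (run_c a u) (le_p _). Qed.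

Lemma polytime_esize f :
  polytime f -> exists2 p, poly_bounded p & forall a, esize (f a) <= p (esize a).
Proof.
move=> [c [k run_c]]; exists (fun n => n + n.+2 ^ k) => [|a]; first by poly_bounded.
by have := runs_height (run_c a [::]); rewrite !cats0 /= !addn0.
Qed.

End PolynomialTime.

Create HintDb polytime.

Ltac polytime := by auto 60 with polytime nocore.

Section Combinators.

Variables A B C : encType.

Lemma polytime_ext (f g : A -> B) : f =1 g -> polytime f -> polytime g.
Proof. by move=> eq_fg [c [k run_f]]; exists c, k => a u; rewrite -eq_fg. Qed.

Lemma polytime_id : polytime (fun a : A => a).
Proof.
apply: (polytime_intro (c := Skip) (p := fun=> 1)) => [|a u]; first by poly_bounded.
exact: runs_skip.
Qed.

Lemma polytime_comp (g : B -> C) (f : A -> B) :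
  polytime g -> polytime f -> polytime (fun a => g (f a)).
Proof.
move=> [cg [kg run_g]] pf; have [q bq le_f] := polytime_esize pf.
case: pf => cf [kf run_f].
apply: (polytime_intro (c := Seq cf cg) (p := fun n => n.+2 ^ kf + (q n).+2 ^ kg)) => [|a u].
  by poly_bounded.
apply: runs_leq (runs_seq (run_f a u) (run_g _ u)) _.
by rewrite leq_add2l leq_expn2r // !ltnS.
Qed.

Lemma polytime_pair (f : A -> B) (g : A -> C) :
  polytime f -> polytime g -> polytime (fun a => (f a, g a)).
Proof.
move=> pf pg; have [qf bqf le_f] := polytime_esize pf; have [qg bqg le_g] := polytime_esize pg.
case: pf pg => cf [kf run_f] [cg [kg run_g]].
apply: (polytime_intro
  (c := Seq dup_tree (Seq cf (Seq swap_trees (Seq cg (Seq swap_trees (Push main true))))))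
  (p := fun n => 12 * n + 5 + (n.+2 ^ kf + (11 * (qf n + n) + 8 + (n.+2 ^ kg
          + (11 * (qg n + qf n) + 8 + 1)))))) => [|a u]; first by poly_bounded.
have swap_f := runs_swap_trees (enc (f a)) (enc a) u.
have swap_g := runs_swap_trees (enc (g a)) (enc (f a)) u.
have build := runs_push main true (operands (bits (f a) ++ bits (g a) ++ u)).
rewrite bits_pair /= -catA.
apply: runs_leq (runs_seq (runs_dup_tree (enc a) u) (runs_seq (run_f a (bits a ++ u))
  (runs_seq swap_f (runs_seq (run_g a (bits (f a) ++ u)) (runs_seq swap_g build))))) _.
by have := le_f a; have := le_g a; rewrite /esize /bits; lia.
Qed.

Lemma polytime_fst : polytime (fun p : A * B => p.1).
Proof.
apply: (polytime_intro (c := Seq (pop main) (Seq swap_trees drop_tree))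
  (p := fun n => 2 + (11 * n + 8 + (7 * n + 3)))) => [|[a b] u]; first by poly_bounded.
rewrite bits_pair cat_cons -catA; apply: runs_leq (runs_seq (runs_pop_operands _ _)
  (runs_seq (runs_swap_trees _ _ _) (runs_drop_tree _ _))) _.
by rewrite esize_pair /esize /bits; lia.
Qed.

Lemma polytime_snd : polytime (fun p : A * B => p.2).
Proof.
apply: (polytime_intro (c := Seq (pop main) drop_tree) (p := fun n => 2 + (7 * n + 3)))
  => [|[a b] u]; first by poly_bounded.
rewrite bits_pair cat_cons -catA.
apply: runs_leq (runs_seq (runs_pop_operands _ _) (runs_drop_tree _ _)) _.
by rewrite esize_pair /esize /bits; lia.
Qed.

Lemma polytime_cst (b : B) : polytime (fun _ : A => b).
Proof.
apply: (polytime_intro (c := Seq drop_tree (pushes main (bits b)))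
  (p := fun n => 7 * n + 3 + (esize b).+1)) => [|a u]; first by poly_bounded.
exact: runs_seq (runs_drop_tree _ _) (runs_pushes main _ (operands u)).
Qed.

Lemma polytime_if (b : A -> bool) (f g : A -> B) :
  polytime b -> polytime f -> polytime g -> polytime (fun a => if b a then f a else g a).
Proof.
move=> [cb [kb run_b]] [cf [kf run_f]] [cg [kg run_g]].
apply: (polytime_intro
  (c := Seq dup_tree (Seq cb (Case main cg (Seq (pop main) (Seq (pop main) cf)))))
  (p := fun n => 12 * n + 5 + (n.+2 ^ kb + (4 + n.+2 ^ kf + n.+2 ^ kg).+1)))
  => [|a u]; first by poly_bounded.
apply: runs_seq (runs_dup_tree _ _) (runs_seq (run_b a _) _); case: (b a).
  apply: (runs_case (b := true) (r := [:: false, false & bits a ++ u])) => //.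
  apply: runs_leq (runs_seq (runs_pop_operands _ _)
    (runs_seq (runs_pop_operands _ _) (run_f a u))) _; lia.
apply: (runs_case (b := false) (r := bits a ++ u)) => //.
by apply: runs_leq (run_g a u) _; lia.
Qed.

End Combinators.

Section Projections.

Variables E A B : encType.

Lemma polytime_fst_of (f : E -> A * B) : polytime f -> polytime (fun e => (f e).1).
Proof. exact: polytime_comp (polytime_fst A B). Qed.

Lemma polytime_snd_of (f : E -> A * B) : polytime f -> polytime (fun e => (f e).2).
Proof. exact: polytime_comp (polytime_snd A B). Qed.

Lemma polytime_same_enc (f : E -> A) (g : E -> B) :
  polytime f -> (forall e, enc (f e) = enc (g e)) -> polytime g.
Proof.
move=> [c [k run_f]] eq_fg; exists c, k => e u.
by rewrite /bits -eq_fg; apply: run_f.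
Qed.

End Projections.

Section Constructors.

Variables E A B : encType.

Lemma polytime_cons (f : E -> A) (g : E -> seq A) :
  polytime f -> polytime g -> polytime (fun e => f e :: g e).
Proof. by move=> pf pg; apply: (polytime_same_enc (polytime_pair pf pg)). Qed.

Lemma polytime_succ (f : E -> nat) : polytime f -> polytime (fun e => (f e).+1).
Proof. by move=> pf; apply: (polytime_same_enc (polytime_pair (polytime_cst _ false) pf)). Qed.

Lemma polytime_inl (f : E -> A) : polytime f -> polytime (fun e => inl (f e) : A + B).
Proof. by move=> pf; apply: (polytime_same_enc (polytime_pair (polytime_cst _ false) pf)). Qed.

Lemma polytime_inr (f : E -> B) : polytime f -> polytime (fun e => inr (f e) : A + B).
Proof. by move=> pf; apply: (polytime_same_enc (polytime_pair (polytime_cst _ true) pf)). Qed.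

Lemma polytime_of_bool (f : bool -> A) : polytime f.
Proof.
apply: (@polytime_ext _ _ (fun b : bool => if b then f true else f false)); first by case.
by apply: polytime_if; [apply: polytime_id | apply: polytime_cst | apply: polytime_cst].
Qed.

End Constructors.

#[export] Hint Extern 0 (polytime (fun _ => ?c)) => exact: polytime_cst : polytime.
#[export] Hint Extern 0 (polytime (fun e => e)) => exact: polytime_id : polytime.
#[export] Hint Extern 0 (polytime fst) => exact: polytime_fst : polytime.
#[export] Hint Extern 0 (polytime snd) => exact: polytime_snd : polytime.
#[export] Hint Extern 1 (polytime (fun e => (_, _))) => apply: polytime_pair : polytime.
#[export] Hint Extern 1 (polytime (fun e => _.1)) => apply: polytime_fst_of : polytime.
#[export] Hint Extern 1 (polytime (fun e => _.2)) => apply: polytime_snd_of : polytime.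
#[export] Hint Extern 1 (polytime (fun e => if _ then _ else _)) =>
  apply: polytime_if : polytime.
#[export] Hint Extern 1 (polytime (fun e => _ :: _)) => apply: polytime_cons : polytime.
#[export] Hint Extern 1 (polytime (fun e => S _)) => apply: polytime_succ : polytime.
#[export] Hint Extern 1 (polytime (fun e => inl _)) => apply: polytime_inl : polytime.
#[export] Hint Extern 1 (polytime (fun e => inr _)) => apply: polytime_inr : polytime.
#[export] Hint Extern 2 (polytime (fun e => ?f _)) =>
  match goal with pf : polytime f |- _ => apply: (polytime_comp pf) end : polytime.
#[export] Hint Extern 2 (polytime (fun e => ?f (@?a e) (@?b e))) =>
  match goal with pf : polytime (fun p => f p.1 p.2) |- _ =>
    apply: (polytime_comp (f := fun e => (a e, b e)) pf) end : polytime.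
#[export] Hint Extern 2 (polytime (fun e => ?f (@?a e) (@?b e) (@?c e))) =>
  match goal with pf : polytime (fun p => f p.1.1 p.1.2 p.2) |- _ =>
    apply: (polytime_comp (f := fun e => (a e, b e, c e)) pf) end : polytime.
(* The other patterns only match abstractions. *)
#[export] Hint Extern 3 (polytime _) =>
  lazymatch goal with
  | |- polytime (fun _ => _) => fail
  | |- @polytime ?A ?B ?f => change (@polytime A B (fun e => f e))
  end : polytime.

Section Fold.

Variables E A B : encType.

Definition fold_loop (c : cmd) : cmd :=
  While main (Seq (pushes main [:: true; true]) (Seq c (pop main))).

Lemma runs_fold_loop (g : B -> A -> B) c W l s u :
    (forall l1 x l2 v, l = l1 ++ x :: l2 ->
       runs c (operands (bits ((x, l2), foldl g s l1) ++ v)) W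
              (operands (bits (l2, g (foldl g s l1) x) ++ v))) ->
  runs (fold_loop c) (operands (bits l ++ bits s ++ u)) (size l * (W + 6) + 1)
       (operands (bits (foldl g s l) ++ u)).
Proof.
elim: l s => [|x l IH] s run_c.
  exact: runs_while_false.
pose v := bits x ++ bits l ++ bits s ++ u.
have pair_up := runs_pushes main [:: true; true] (operands v).
have run_body := run_c [::] x l u erefl; rewrite !bits_pair !cat_cons -!catA in run_body.
have unpair := runs_pop_operands true (bits l ++ bits (g s x) ++ u).
have loop := IH (g s x) (fun l1 y l2 w eq_l => run_c (x :: l1) y l2 w (congr1 (cons x) eq_l)).
have top : qget main (operands (true :: v)) = true :: v by [].
rewrite bits_cons cat_cons -catA.
apply: runs_leq (runs_while_true top (runs_seq pair_up (runs_seq run_body unpair)) loop) _.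
by rewrite /=; lia.
Qed.

Lemma polytime_fold (g : B -> A -> B) (s : E -> B) (l : E -> seq A) q :
    polytime (fun p : B * A => g p.1 p.2) -> polytime s -> polytime l ->
    poly_bounded q ->
    (forall e l1 l2, l e = l1 ++ l2 -> esize (foldl g (s e) l1) <= q (esize e)) ->
  polytime (fun e => foldl g (s e) (l e)).
Proof.
move=> pg ps pl bq le_q; have [r br le_r] := polytime_esize pl.
have [c0 [k0 run_c0]] : polytime (fun e => (l e, s e)) by polytime.
have [c [k run_c]] : polytime (fun p : (A * seq A) * B => (p.1.2, g p.2 p.1.1)).
  by polytime.
pose W n := (q n + r n + 1).+2 ^ k.
apply: (polytime_intro (c := Seq c0 (Seq (pop main) (fold_loop c)))
  (p := fun n => n.+2 ^ k0 + (2 + (r n * (W n + 6) + 1)))) => [|e u].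
  by rewrite /W; poly_bounded.
have run_l := run_c0 e u; rewrite bits_pair cat_cons -catA in run_l.
have run_step l1 x l2 v : l e = l1 ++ x :: l2 ->
    runs c (operands (bits ((x, l2), foldl g (s e) l1) ++ v)) (W (esize e))
           (operands (bits (l2, g (foldl g (s e) l1) x) ++ v)).
  move=> eq_l; apply: runs_leq (run_c _ _) (leq_expn2r _ _).
  have := le_r e; have := le_q _ _ _ eq_l; have := esize_cat l1 (x :: l2).
  by rewrite -eq_l !esize_pair esize_cons; have := esize_gt0 l1; lia.
apply: runs_leq (runs_seq run_l
  (runs_seq (runs_pop_operands _ _) (runs_fold_loop u run_step))) _.
rewrite !leq_add2l leq_add2r leq_mul //.
by have := le_r e; have := size_esize (l e); lia.
Qed.

End Fold.

Section ParameterizedFold.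

Variables E A B : encType.
Variables (g : E -> B -> A -> B) (s : E -> B) (l : E -> seq A).

Lemma polytime_foldl_bounded q :
    polytime (fun p : E * B * A => g p.1.1 p.1.2 p.2) -> polytime s -> polytime l ->
    poly_bounded q ->
    (forall e l1 l2, l e = l1 ++ l2 -> esize (foldl (g e) (s e) l1) <= q (esize e)) ->
  polytime (fun e => foldl (g e) (s e) (l e)).
Proof.
move=> pg ps pl bq le_q; pose g' (p : E * B) x := (p.1, g p.1 p.2 x).
have foldl_g' e l1 s1 : foldl g' (e, s1) l1 = (e, foldl (g e) s1 l1).
  by elim: l1 s1 => //= x l1 IH s1; rewrite IH.
apply: (polytime_ext (f := fun e => (foldl g' (e, s e) (l e)).2)) => [e|].
  by rewrite foldl_g'.
apply: polytime_snd_of.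
apply: (polytime_fold (q := fun n => n + q n + 1)).
- by rewrite /g'; polytime.
- by polytime.
- by polytime.
- by poly_bounded.
- by move=> e l1 l2 eq_l; rewrite foldl_g' esize_pair; have := le_q _ _ _ eq_l; lia.
Qed.

Lemma polytime_foldl r :
    polytime (fun p : E * B * A => g p.1.1 p.1.2 p.2) -> polytime s -> polytime l ->
    poly_bounded r ->
    (forall e b x, esize (g e b x) <= esize b + r (esize e + esize x)) ->
  polytime (fun e => foldl (g e) (s e) (l e)).
Proof.
move=> pg ps pl [k le_r] grow.
have [ql bql le_ql] := polytime_esize pl; have [qs bqs le_qs] := polytime_esize ps.
apply: (polytime_foldl_bounded (q := fun n => qs n + ql n * (n + ql n).+2 ^ k))
  => // [|e l1 l2 eq_l].
  by poly_bounded.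
pose W := (esize e + ql (esize e)).+2 ^ k.
have le_l1 : esize l1 <= ql (esize e).
  by apply: leq_trans (le_ql e); rewrite eq_l esize_catl.
have grow_l1 b : esize (foldl (g e) b l1) <= esize b + size l1 * W.
  elim: l1 b le_l1 {eq_l} => [|x l1 IH] b /=; first by lia.
  rewrite esize_cons => le_l1; apply: leq_trans (IH _ _) _; first by lia.
  have : r (esize e + esize x) <= W by apply: leq_trans (le_r _) (leq_expn2r _ _); lia.
  by rewrite mulSn; have := grow e b x; lia.
apply: leq_trans (grow_l1 _) (leq_add (le_qs e) _).
by rewrite leq_mul // (leq_trans (ltnW (size_esize l1)) le_l1).
Qed.

End ParameterizedFold.

(** * A library of polynomial-time functions *)

Section Lists.

Variables E A : encType.
Implicit Types s t : E -> seq A.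

Lemma polytime_catrev s t : polytime s -> polytime t -> polytime (fun e => catrev (s e) (t e)).
Proof.
move=> ps pt; apply: (polytime_ext (f := fun e => foldl (fun acc x => x :: acc) (t e) (s e))).
  by move=> e; elim: (s e) (t e) => //= x l IH y; rewrite IH.
apply: (polytime_foldl (r := fun n => n + 1)).
- by polytime.
- by polytime.
- by polytime.
- by poly_bounded.
- by move=> e b x; rewrite esize_cons; lia.
Qed.

Lemma polytime_rev s : polytime s -> polytime (fun e => rev (s e)).
Proof. by move=> ps; apply: polytime_catrev; polytime. Qed.

Lemma polytime_cat s t : polytime s -> polytime t -> polytime (fun e => s e ++ t e).
Proof.
move=> ps pt; apply: (polytime_ext (f := fun e => catrev (rev (s e)) (t e))) => [e|].
  by rewrite catrevE revK.
by apply: polytime_catrev pt; apply: polytime_rev.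
Qed.

End Lists.

#[export] Hint Extern 1 (polytime (fun e => rev _)) => apply: polytime_rev : polytime.
#[export] Hint Extern 1 (polytime (fun e => _ ++ _)) => apply: polytime_cat : polytime.

Section Map.

Variables E A B : encType.

Lemma polytime_map (f : E -> A -> B) (s : E -> seq A) :
    polytime (fun p : E * A => f p.1 p.2) -> polytime s ->
  polytime (fun e => [seq f e x | x <- s e]).
Proof.
move=> pf ps; have [q bq le_q] := polytime_esize pf; have [k le_k] := bq.
pose g e acc x := f e x :: acc.
apply: (polytime_ext (f := fun e => rev (foldl (g e) [::] (s e)))) => [e|].
  suff revmap u : foldl (g e) u (s e) = catrev (map (f e) (s e)) u by rewrite revmap revK.
  by elim: (s e) u => //= x l IH u; rewrite IH.
apply: polytime_rev.
apply: (polytime_foldl (r := fun n => n.+3 ^ k + 1)).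
- by rewrite /g; polytime.
- by polytime.
- by polytime.
- by poly_bounded.
- move=> e b x; rewrite esize_cons; have := leq_trans (le_q (e, x)) (le_k _).
  by rewrite esize_pair /=; lia.
Qed.

End Map.

#[export] Hint Extern 1 (polytime (fun e => map (@?f e) (@?s e))) =>
  apply: (@polytime_map _ _ _ f s) : polytime.

Section Booleans.

Variable E : encType.
Implicit Types a b : E -> bool.

Lemma polytime_negb a : polytime a -> polytime (fun e => ~~ a e).
Proof. by move=> pa; apply: polytime_comp (polytime_of_bool negb) pa. Qed.

Lemma polytime_andb a b : polytime a -> polytime b -> polytime (fun e => a e && b e).
Proof.
move=> pa pb; apply: (polytime_ext (f := fun e => if a e then b e else false)) => [e|].
  by case: (a e).
by polytime.
Qed.

Lemma polytime_eqb a b : polytime a -> polytime b -> polytime (fun e => a e == b e).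
Proof.
move=> pa pb; apply: (polytime_ext (f := fun e => if a e then b e else ~~ b e)) => [e|].
  by case: (a e) (b e) => [] [].
by have pNb := polytime_negb pb; polytime.
Qed.

End Booleans.

#[export] Hint Extern 1 (polytime (fun e => ~~ _)) => apply: polytime_negb : polytime.
#[export] Hint Extern 1 (polytime (fun e => _ && _)) => apply: polytime_andb : polytime.

Section Sequences.

Variables E A : encType.
Implicit Types s : E -> seq A.

Lemma polytime_all (p : E -> pred A) s :
    polytime (fun q : E * A => p q.1 q.2) -> polytime s ->
  polytime (fun e => all (p e) (s e)).
Proof.
move=> pp ps; pose g e b x := b && p e x.
apply: (polytime_ext (f := fun e => foldl (g e) true (s e))) => [e|].
  by rewrite -[RHS]/(true && _); elim: (s e) true => [|x l IH] b /=; rewrite ?andbT // IH andbA.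
apply: (polytime_foldl (r := fun=> 3)).
- by rewrite /g; polytime.
- by polytime.
- by polytime.
- by poly_bounded.
- by move=> e b x; have := esize_bool (g e b x); lia.
Qed.

Lemma polytime_has (p : E -> pred A) s :
    polytime (fun q : E * A => p q.1 q.2) -> polytime s ->
  polytime (fun e => has (p e) (s e)).
Proof.
move=> pp ps; apply: (polytime_ext (f := fun e => ~~ all (fun x => ~~ p e x) (s e))) => [e|].
  by rewrite -has_predC; apply: eq_has => x /=; rewrite negbK.
by apply: polytime_negb; apply: (@polytime_all (fun e x => ~~ p e x)); polytime.
Qed.

Lemma polytime_count (p : E -> pred A) s :
    polytime (fun q : E * A => p q.1 q.2) -> polytime s ->
  polytime (fun e => count (p e) (s e)).
Proof.
move=> pp ps; pose g e n x := if p e x then n.+1 else n.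
apply: (polytime_ext (f := fun e => foldl (g e) 0 (s e))) => [e|].
  rewrite -[RHS]add0n; elim: (s e) 0 => [|x l IH] n /=; rewrite ?addn0 // IH /g.
  by case: (p e x); rewrite ?addSnnS.
apply: (polytime_foldl (r := fun=> 2)).
- by rewrite /g; polytime.
- by polytime.
- by polytime.
- by poly_bounded.
- by move=> e n x; rewrite /g; case: (p e x); rewrite !esize_nat; lia.
Qed.

Lemma polytime_size s : polytime s -> polytime (fun e => size (s e)).
Proof.
move=> ps; apply: (polytime_ext (f := fun e => count predT (s e))) => [e|].
  by rewrite count_predT.
exact: (@polytime_count (fun=> predT) s (polytime_cst _ true) ps).
Qed.

Lemma polytime_nilp s : polytime s -> polytime (fun e => nilp (s e)).
Proof.
move=> ps; apply: (polytime_ext (f := fun e => all pred0 (s e))) => [e|]; first by case: (s e).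
exact: (@polytime_all (fun=> pred0) s (polytime_cst _ false) ps).
Qed.

Lemma polytime_behead s : polytime s -> polytime (fun e => behead (s e)).
Proof.
apply: polytime_comp; apply: (polytime_intro (c := Case main (Push main false) drop_tree)
  (p := fun n => (7 * n + 3).+1)) => [|[|x l] u]; first by poly_bounded.
  apply: (@runs_leq _ _ 2); last by rewrite esize_nil.
  by apply: (runs_case (b := false) (r := u)) => //; apply: runs_push.
apply: (runs_case (b := true) (r := bits x ++ bits l ++ u)).
  by rewrite bits_cons cat_cons -catA.
by apply: runs_leq (runs_drop_tree _ _) _; rewrite esize_cons /esize /bits; lia.
Qed.

Lemma polytime_head (x0 : A) s : polytime s -> polytime (fun e => head x0 (s e)).
Proof.
move=> ps; pose g (p : bool * A) x := if p.1 then p else (true, x).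
apply: (polytime_ext (f := fun e => (foldl g (false, x0) (s e)).2)) => [e|].
  by case: (s e) => // x l; rewrite /= {2}/g /=; elim: l => //= y l ->.
apply: polytime_snd_of.
apply: (polytime_foldl (r := fun n => n + 4)).
- by rewrite /g; polytime.
- by polytime.
- by polytime.
- by poly_bounded.
- move=> e b x; rewrite /g; case: ifP => _; first by lia.
  by rewrite !esize_pair; have := esize_bool true; lia.
Qed.

Lemma polytime_nseq (x : E -> A) (n : E -> nat) :
  polytime x -> polytime n -> polytime (fun e => nseq (n e) (x e)).
Proof.
move=> px pn; have pnseq : polytime (fun e => nseq (n e) false).
  apply: (polytime_same_enc pn) => e.
  by rewrite -[LHS]/(enc_nat _) -[RHS]/(enc_seq _); elim: (n e) => //= m ->.
apply: (polytime_ext (f := fun e => [seq x e | _ <- nseq (n e) false])) => [e|].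
  by rewrite map_nseq.
by polytime.
Qed.

End Sequences.

#[export] Hint Extern 1 (polytime (fun e => all (@?p e) (@?s e))) =>
  apply: (@polytime_all _ _ p s) : polytime.
#[export] Hint Extern 1 (polytime (fun e => has (@?p e) (@?s e))) =>
  apply: (@polytime_has _ _ p s) : polytime.
#[export] Hint Extern 1 (polytime (fun e => count (@?p e) (@?s e))) =>
  apply: (@polytime_count _ _ p s) : polytime.
#[export] Hint Extern 1 (polytime (fun e => size _)) => apply: polytime_size : polytime.
#[export] Hint Extern 1 (polytime (fun e => nilp _)) => apply: polytime_nilp : polytime.
#[export] Hint Extern 1 (polytime (fun e => behead _)) => apply: polytime_behead : polytime.
#[export] Hint Extern 1 (polytime (fun e => head _ _)) => apply: polytime_head : polytime.
#[export] Hint Extern 1 (polytime (fun e => nseq _ _)) => apply: polytime_nseq : polytime.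

Section FlattenAndIndexing.

Variables E A : encType.

Lemma polytime_flatten (s : E -> seq (seq A)) :
  polytime s -> polytime (fun e => flatten (s e)).
Proof.
move=> ps; apply: (polytime_ext (f := fun e => foldl cat [::] (s e))) => [e|].
  rewrite -[RHS]/([::] ++ _).
  by elim: (s e) [::] => [|x l IH] b /=; rewrite ?cats0 // IH catA.
apply: (polytime_foldl (r := id)).
- by polytime.
- by polytime.
- by polytime.
- exact: poly_bounded_id.
- by move=> e b x; have := esize_cat b x; rewrite /=; lia.
Qed.

Lemma polytime_nth (x0 : A) (s : E -> seq A) (n : E -> nat) :
  polytime s -> polytime n -> polytime (fun e => nth x0 (s e) (n e)).
Proof.
move=> ps pn; pose g (l : seq A) (_ : bool) := behead l.
apply: (polytime_ext (f := fun e => head x0 (foldl g (s e) (nseq (n e) false)))) => [e|].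
  by elim: (n e) (s e) => [|m IH] [|x l] //=; rewrite IH ?nth_nil.
apply: polytime_head.
apply: (polytime_foldl (r := fun=> 1)).
- by rewrite /g; polytime.
- by polytime.
- by polytime.
- by poly_bounded.
- by move=> e [|x l] b; rewrite /g /= ?esize_cons; lia.
Qed.

End FlattenAndIndexing.

#[export] Hint Extern 1 (polytime (fun e => flatten _)) => apply: polytime_flatten : polytime.
#[export] Hint Extern 1 (polytime (fun e => nth _ _ _)) => apply: polytime_nth : polytime.

Lemma esize_iota m n : esize (iota m n) <= n * (2 * (m + n) + 2) + 1.
Proof.
by elim: n m => // n IH m; rewrite /= esize_cons esize_nat; have := IH m.+1; nia.
Qed.

Section Arithmetic.

Variable E : encType.

Lemma polytime_addn (m n : E -> nat) :
  polytime m -> polytime n -> polytime (fun e => m e + n e).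
Proof.
move=> pm pn.
apply: (polytime_ext (f := fun e => size (nseq (m e) false ++ nseq (n e) false))) => [e|].
  by rewrite size_cat !size_nseq.
by polytime.
Qed.

Lemma polytime_muln (m n : E -> nat) :
  polytime m -> polytime n -> polytime (fun e => m e * n e).
Proof.
move=> pm pn.
apply: (polytime_ext (f := fun e => size (flatten (nseq (m e) (nseq (n e) false))))) => [e|].
  by rewrite size_flatten /shape map_nseq size_nseq sumn_nseq mulnC.
by polytime.
Qed.

Lemma polytime_expn (n : E -> nat) k : polytime n -> polytime (fun e => n e ^ k).
Proof.
move=> pn; elim: k => [|k IH]; first exact: polytime_cst.
apply: (polytime_ext (f := fun e => n e * n e ^ k)) => [e|]; first by rewrite expnS.
exact: polytime_muln.
Qed.

Lemma polytime_poly_bound k (n : E -> nat) :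
  polytime n -> polytime (fun e => poly_bound k (n e)).
Proof.
move=> pn; apply: polytime_addn (polytime_cst _ _).
exact: polytime_muln (polytime_cst _ _) (polytime_expn k pn).
Qed.

Lemma polytime_iota (n : E -> nat) : polytime n -> polytime (fun e => iota 0 (n e)).
Proof.
move=> pn; pose g (acc : seq nat) (_ : bool) := rcons acc (size acc).
have foldl_g m : foldl g [::] (nseq m false) = iota 0 m.
  by elim: m => // m IH; rewrite -addn1 nseqD foldl_cat IH iotaD /= /g size_iota cats1.
apply: (polytime_ext (f := fun e => foldl g [::] (nseq (n e) false))) => [e|].
  exact: foldl_g.
have [q bq le_q] := polytime_esize pn.
apply: (polytime_foldl_bounded (q := fun k => q k * (2 * q k + 2) + 1)).
- apply: (polytime_ext (f := fun p : E * seq nat * bool => p.1.2 ++ [:: size p.1.2])) => [p|].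
    by rewrite cats1.
  by polytime.
- by polytime.
- by polytime.
- by poly_bounded.
- move=> e l1 l2 eq_l.
  have le_l1 : size l1 <= n e by rewrite -(size_nseq (n e) false) eq_l size_cat leq_addr.
  have /all_pred1P -> : all (pred1 false) l1.
    have : all (pred1 false) (nseq (n e) false) by rewrite all_nseq orbT.
    by rewrite eq_l all_cat => /andP[].
  have := le_q e; rewrite esize_nat foldl_g; move: (size l1) le_l1 => m le_m lt_n.
  by apply: leq_trans (esize_iota _ _) _; rewrite leq_add2r leq_mul //; lia.
Qed.

End Arithmetic.

#[export] Hint Extern 1 (polytime (fun e => _ + _)) => apply: polytime_addn : polytime.
#[export] Hint Extern 1 (polytime (fun e => _ * _)) => apply: polytime_muln : polytime.
#[export] Hint Extern 1 (polytime (fun e => poly_bound _ _)) =>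
  apply: polytime_poly_bound : polytime.
#[export] Hint Extern 1 (polytime (fun e => iota 0 _)) => apply: polytime_iota : polytime.

(** * Serialization *)

Definition push_bit (i : idx) (b : bool) : cmd := pushes i (true :: bits b).

Definition cons_bits (i j : idx) : cmd := Each i (push_bit j false) (push_bit j true).

Lemma runs_cons_bits i j (l : seq bool) u s : i != j -> qget j s = bits l ++ u ->
  runs (cons_bits i j) s (6 * size (qget i s) + 1)
    (qset j (bits (catrev (qget i s) l) ++ u) (qset i [::] s)).
Proof.
move=> neq_ij; move: {-1}(qget i s) (erefl (qget i s)) => x.
elim: x l s => [|b x IH] l s top top_j.
  by rewrite (qset_id top) /= qset_id //; apply: runs_each_nil.
have neq_ji : j != i by rewrite eq_sym.
pose s' := qset j (bits (b :: l) ++ u) (qset i x s).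
have push_b : runs (if b then push_bit j true else push_bit j false) (qset i x s) 5 s'.
  have := runs_pushes j (true :: bits b) (qset i x s).
  rewrite qget_qset (negbTE neq_ji) top_j.
  by rewrite /s' bits_cons catA; case: b {top s'} => run; apply: runs_leq run _.
have top' : qget i s' = x by rewrite qget_qset (negbTE neq_ij) qget_qset_same.
have := runs_each_cons top push_b (IH _ _ top' (qget_qset_same _ _ _)).
rewrite (qsetC _ _ _ neq_ij) !qset_qset => run.
by apply: runs_leq run _; rewrite /=; lia.
Qed.

Lemma polytime_bits (A : encType) : polytime (@bits A).
Proof.
apply: (polytime_intro (c := Seq move_tree (Seq (Push main false) (cons_bits buffer main)))
  (p := fun n => 5 * n + 2 + (1 + (6 * n + 1)))) => [|a u]; first by poly_bounded.
have start := runs_push main false (u, rev (bits a), [::], [::]).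
have build := @runs_cons_bits buffer main [::] u
  (false :: u, rev (bits a), [::], [::]) isT erefl.
rewrite /= catrevE revK cats0 size_rev in build.
by apply: runs_leq (runs_seq (runs_move_tree (enc a) u [::]) (runs_seq start build)) _.
Qed.

#[export] Hint Extern 1 (polytime (fun e => bits _)) =>
  apply: (polytime_comp (@polytime_bits _)) : polytime.

Definition restore : cmd := Seq (transfer buffer spare) (transfer spare main).

Lemma runs_restore u x :
  runs restore (u, x, [::], [::]) (4 * size x + 2) (operands (x ++ u)).
Proof.
have save := @runs_transfer buffer spare (u, x, [::], [::]) isT.
have reload := @runs_transfer_rev spare main x (u, [::], [::], rev x) isT erefl.
by apply: runs_leq (runs_seq save reload) _; rewrite /=; lia.
Qed.

Definition read_input : cmd := Seq (Push buffer false) (Seq (cons_bits main buffer) restore).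

Lemma runs_read_input w :
  runs read_input (entry w) (22 * size w + 8) (operands (bits w)).
Proof.
have start := runs_push buffer false (entry w).
have build := @runs_cons_bits main buffer [::] [::] (rev w, [:: false], [::], [::]) isT erefl.
rewrite /= catrevE revK !cats0 size_rev in build.
have := runs_restore [::] (bits w); rewrite cats0 => reload.
apply: runs_leq (runs_seq start (runs_seq build reload)) _.
by have := esize_bits w; rewrite /esize; lia.
Qed.

Definition unload_bit : cmd :=
  Case main (Push buffer false) (Seq (pop main) (Seq (pop main) (Push buffer true))).

Definition unload_bits : cmd := While main unload_bit.

Lemma runs_unload_bits (w : seq bool) x :
  runs unload_bits (bits w, x, [::], [::]) (8 * size w + 1) ([::], catrev w x, [::], [::]).
Proof.
elim: w x => [|b w IH] x.
  exact: runs_while_false.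
pose S v y : stacks := (v, y, [::], [::]).
have unload : runs unload_bit (S (bits b ++ bits w) x) 6 (S (bits w) (b :: x)).
  case: b.
    apply: (runs_case (b := true) (r := [:: false, false & bits w])) => //.
    have pop_leaf v : runs (pop main) (S (false :: v) x) 2 (S v x).
      exact: (runs_pop (b := false)).
    exact: runs_seq (pop_leaf _) (runs_seq (pop_leaf _) (runs_push buffer true (S (bits w) x))).
  apply: (runs_case (b := false) (r := bits w)) => //.
  by apply: runs_leq (runs_push buffer false (S (bits w) x)) _.
have top : qget main (S (bits (b :: w)) x) = true :: bits b ++ bits w by [].
by apply: runs_leq (runs_while_true top unload (IH _)) _; rewrite /=; lia.
Qed.

Lemma polytime_in_FP (f : seq bool -> seq bool) : polytime f -> in_FP f.
Proof.
move=> pf; have [q [l le_q] le_f] := polytime_esize pf; case: pf => c [k run_c].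
pose input_size n := 4 * n + 1; pose output_size n := (input_size n).+2 ^ l.
apply: (@transducer_in_FP (Seq read_input (Seq c (Seq unload_bits restore))) f
  (fun n => 22 * n + 8 + ((input_size n).+2 ^ k
    + (8 * output_size n + 1 + (4 * output_size n + 2))))) => [|w].
  by rewrite /output_size /input_size; poly_bounded.
have run_f := run_c w [::]; rewrite !cats0 in run_f.
have reload := runs_restore [::] (rev (f w)); rewrite cats0 in reload.
exists (operands (rev (f w))) => //.
apply: runs_leq (runs_seq (runs_read_input w)
  (runs_seq run_f (runs_seq (runs_unload_bits (f w) [::]) reload))) _.
have le_w : esize w <= input_size (size w) := esize_bits w.
have : (esize w).+2 ^ k <= (input_size (size w)).+2 ^ k by rewrite leq_expn2r.
have : size (f w) <= output_size (size w).
  apply: leq_trans (ltnW (size_esize (f w))) (leq_trans (le_f w) (leq_trans (le_q _) _)).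
  by rewrite leq_expn2r.
by rewrite size_rev; lia.
Qed.

Lemma polytime_in_P (f : seq bool -> bool) : polytime f -> in_P (fun w => f w).
Proof.
move=> [c [k run_c]].
apply: (@decider_in_P (Seq read_input c) f (fun n => 22 * n + 8 + (4 * n + 1).+2 ^ k)) => [|w].
  by poly_bounded.
have run_f := run_c w [::]; rewrite !cats0 in run_f.
exists (operands (bits (f w))), (behead (bits (f w))); split; last by case: (f w).
apply: runs_leq (runs_seq (runs_read_input w) run_f) _.
by rewrite leq_add2l leq_expn2r // !ltnS esize_bits.
Qed.

Lemma polytime_eq_bits (E : encType) (s t : E -> seq bool) :
  polytime s -> polytime t -> polytime (fun e => s e == t e).
Proof.
move=> ps pt.
pose g (p : seq bool * bool) b := (behead p.1, [&& p.2, ~~ nilp p.1 & head false p.1 == b]).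
pose run_g e := foldl g (t e, true) (s e).
apply: (polytime_ext (f := fun e => (run_g e).2 && nilp (run_g e).1)) => [e|].
  rewrite /run_g -[RHS]/(true && _); elim: (s e) (t e) true => [|b l IH] [|c u] d //=.
  - by rewrite !IH /= !andbF.
  - by rewrite IH eqseq_cons eq_sym -andbA.
have p_run : polytime run_g; last by polytime.
apply: (polytime_foldl (r := fun=> 3)).
- have p_head : polytime (fun p : E * (seq bool * bool) * bool => head false p.1.2.1 == p.2).
    by apply: polytime_eqb; polytime.
  by rewrite /g; polytime.
- by polytime.
- by polytime.
- by poly_bounded.
- move=> e [l c] b; rewrite /g /= !esize_pair.
  have := esize_bool [&& c, ~~ nilp l & head false l == b].
  by case: l => [|x l]; rewrite ?esize_cons /=; lia.
Qed.

Lemma polytime_eqop (E A : encType) (a b : E -> A) :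
  polytime a -> polytime b -> polytime (fun e => a e == b e).
Proof.
move=> pa pb; apply: (polytime_ext (f := fun e => bits (a e) == bits (b e))) => [e|].
  exact: inj_eq (@bits_inj A) _ _.
by apply: polytime_eq_bits; polytime.
Qed.

#[export] Hint Extern 1 (polytime (fun e => _ == _)) => apply: polytime_eqop : polytime.

Lemma polytime_mem (E A : encType) (a : E -> A) (s : E -> seq A) :
  polytime a -> polytime s -> polytime (fun e => a e \in s e).
Proof.
move=> pa ps; apply: (polytime_ext (f := fun e => has (fun x => x == a e) (s e))) => [e|].
  by rewrite -has_pred1.
by polytime.
Qed.

#[export] Hint Extern 1 (polytime (fun e => _ \in _)) => apply: polytime_mem : polytime.

Lemma polytime_undup (E A : encType) (s : E -> seq A) :
  polytime s -> polytime (fun e => undup (s e)).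
Proof.
move=> ps; pose g (acc : seq A) x := if x \in acc then acc else x :: acc.
apply: (polytime_ext (f := fun e => foldl g [::] (rev (s e)))) => [e|].
  by rewrite foldl_rev; elim: (s e) => //= x l ->; rewrite /g mem_undup.
apply: (polytime_foldl (r := fun n => n + 1)).
- by rewrite /g; polytime.
- by polytime.
- by polytime.
- by poly_bounded.
- by move=> e b x; rewrite /g; case: ifP => _; rewrite ?esize_cons; lia.
Qed.

#[export] Hint Extern 1 (polytime (fun e => undup _)) => apply: polytime_undup : polytime.

Lemma polytime_leq (E : encType) (m n : E -> nat) :
  polytime m -> polytime n -> polytime (fun e => m e <= n e).
Proof.
move=> pm pn; apply: (polytime_ext (f := fun e => m e \in iota 0 (n e).+1)) => [e|].
  by rewrite mem_iota ltnS.
by polytime.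
Qed.

Lemma polytime_constant (E A : encType) (x0 : A) (s : E -> seq A) :
  polytime s -> polytime (fun e => constant (s e)).
Proof.
move=> ps.
apply: (polytime_ext (f := fun e => all (fun x => x == head x0 (s e)) (s e))) => [e|].
  by case: (s e) => //= x l; rewrite eqxx.
by polytime.
Qed.

#[export] Hint Extern 1 (polytime (fun e => _ <= _)) => apply: polytime_leq : polytime.
#[export] Hint Extern 1 (polytime (fun e => constant _)) =>
  apply: (@polytime_constant _ _ 0) : polytime.

(** * Formulas over arbitrary variables *)

Definition lit_over (T : Type) := (bool * T)%type.
Definition clause_over (T : Type) := (lit_over T * lit_over T * lit_over T)%type.

Section Formulas.

Variable T : Type.
Implicit Types (c : clause_over T) (F : seq (clause_over T)).

Definition lits c : seq (lit_over T) := [:: c.1.1; c.1.2; c.2].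
Definition all_lits F : seq (lit_over T) := flatten (map lits F).
Definition true_lit (val : T -> bool) (l : lit_over T) : bool := val l.2 == l.1.
Definition true_count (val : T -> bool) c : nat := count (true_lit val) (lits c).

Definition satisfied (val : T -> bool) c : bool := 0 < true_count val c.

Definition sat F : Prop := exists val, all (satisfied val) F.
Definition one_sat F : Prop := exists val, all (fun c => true_count val c == 1) F.
Definition same_sat F : Prop := exists val k, all (fun c => true_count val c == k) F.

Lemma all_lits_cons c F : all_lits (c :: F) = lits c ++ all_lits F. Proof. by []. Qed.

Lemma all_lits_cat F G : all_lits (F ++ G) = all_lits F ++ all_lits G.
Proof. by rewrite /all_lits map_cat flatten_cat. Qed.

Lemma same_satE F : same_sat F <-> exists val, constant [seq true_count val c | c <- F].
Proof.
split=> [[val [k same]]|[val /(constantP 0)[k def_counts]]].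
  by exists val; apply: (@all_pred1_constant _ k); rewrite all_map.
by exists val, k; have := all_pred1_nseq k (size [seq true_count val c | c <- F]);
  rewrite -def_counts all_map.
Qed.

End Formulas.

Section Occurrences.

Variable T : eqType.
Implicit Type F : seq (clause_over T).

Definition occ F (v : T) : nat := count (fun l => l.2 == v) (all_lits F).

Lemma mem_all_lits F c l : c \in F -> l \in lits c -> l \in all_lits F.
Proof. by move=> Fc cl; apply/flatten_mapP; exists c. Qed.

Lemma occ_cat F G v : occ (F ++ G) v = occ F v + occ G v.
Proof. by rewrite /occ all_lits_cat count_cat. Qed.

Lemma occ_le k F :
  (forall l, l \in all_lits F -> occ F l.2 <= k) -> forall v, occ F v <= k.
Proof.
move=> le_k v; case: (posnP (occ F v)) => [-> //|].
by rewrite -has_count => /hasP[l Fl /eqP <-]; apply: le_k.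
Qed.

Lemma eq_true_count (val1 val2 : T -> bool) c :
  {in lits c, forall l, val1 l.2 = val2 l.2} -> true_count val1 c = true_count val2 c.
Proof. by move=> eq_val; apply: eq_in_count => l cl; rewrite /true_lit eq_val. Qed.

End Occurrences.

Definition rename_lit T U (phi : T -> U) (l : lit_over T) : lit_over U := (l.1, phi l.2).

Definition rename_clause T U (phi : T -> U) (c : clause_over T) : clause_over U :=
  (rename_lit phi c.1.1, rename_lit phi c.1.2, rename_lit phi c.2).

Definition rename T U (phi : T -> U) : seq (clause_over T) -> seq (clause_over U) :=
  map (rename_clause phi).

Lemma all_lits_rename T U (phi : T -> U) F :
  all_lits (rename phi F) = map (rename_lit phi) (all_lits F).
Proof. by elim: F => //= c F IH; rewrite !all_lits_cons IH. Qed.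

Lemma true_count_rename T U (phi : T -> U) val c :
  true_count val (rename_clause phi c) = true_count (val \o phi) c.
Proof. by []. Qed.

Lemma renameK T U (phi : T -> U) psi : cancel phi psi -> cancel (rename phi) (rename psi).
Proof.
move=> phiK; apply: mapK => -[[[s1 v1] [s2 v2]] [s3 v3]].
by rewrite /rename_clause /rename_lit /= !phiK.
Qed.

Section InjectiveRenaming.

Variables (T U : eqType) (phi : T -> U).
Hypothesis phi_inj : injective phi.

Lemma occ_rename_le k F :
  (forall v, occ F v <= k) -> forall u, occ (rename phi F) u <= k.
Proof.
move=> le_k; apply: occ_le => l; rewrite all_lits_rename => /mapP[l' _ ->].
rewrite /occ all_lits_rename count_map (@eq_count _ _ (fun l => l.2 == l'.2)) ?le_k //.
by move=> l'' /=; rewrite (inj_eq phi_inj).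
Qed.

Lemma same_sat_rename F : same_sat (rename phi F) <-> same_sat F.
Proof.
split=> -[val [k same]].
  by exists (val \o phi), k; rewrite all_map in same.
pose val' u := has (fun l => (phi l.2 == u) && val l.2) (all_lits F).
exists val', k; rewrite all_map; apply/allP => c Fc; rewrite /= -(eqP (allP same c Fc)).
rewrite true_count_rename (@eq_true_count _ (val' \o phi) val) // => l cl /=.
have Fl := mem_all_lits Fc cl.
apply/hasP/idP => [[l' _ /andP[/eqP/phi_inj -> //]]|val_l].
by exists l => //; rewrite eqxx.
Qed.

End InjectiveRenaming.

Lemma clause_litsE (c : clause) : clause_lits c = lits c.
Proof. by case: c => [[]]. Qed.

Lemma occurrencesE (F : formula) v : occurrences F v = occ F v.
Proof. by rewrite /occurrences (eq_map clause_litsE). Qed.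

Lemma all_the_same_satE (F : formula) : all_the_same_sat F <-> same_sat F.
Proof.
by split=> -[val [k same]]; exists val, k; apply: sub_all same => c;
  rewrite /ntrue clause_litsE.
Qed.

(** * Parsing of encoded formulas *)

Definition block (s : seq bool) : seq bool := data_bits s ++ [:: false; false].
Definition concat_blocks (bs : seq (seq bool)) : seq bool := flatten (map block bs).

(* A state holds the first bit of the current pair if it has been read, the current
   block, and the list of finished blocks. *)
Definition split_state := (seq bool * seq bool * seq (seq bool))%type.

Definition split_step (p : split_state) (b : bool) : split_state :=
  if nilp p.1.1 then ([:: b], p.1.2, p.2)
  else if head false p.1.1 then ([::], p.1.2 ++ [:: b], p.2)
  else ([::], [::], p.2 ++ [:: p.1.2]).

Definition split_blocks (s : seq bool) : seq (seq bool) :=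
  (foldl split_step ([::], [::], [::]) s).2.

Lemma foldl_split_block cur bs s r :
  foldl split_step ([::], cur, bs) (block s ++ r) =
  foldl split_step ([::], [::], bs ++ [:: cur ++ s]) r.
Proof.
by elim: s cur => [|b s IH] cur; rewrite /= /split_step /= ?cats0 // IH -catA.
Qed.

Lemma foldl_split_done pending cur bs bs' r :
  (foldl split_step (pending, cur, bs ++ bs') r).2 =
  bs ++ (foldl split_step (pending, cur, bs') r).2.
Proof.
elim: r pending cur bs' => //= b r IH pending cur bs'; rewrite /split_step /=.
by case: (nilp pending) => //; case: (head false pending); rewrite // -catA IH.
Qed.

Lemma split_blocks_block s r : exists bs, split_blocks (block s ++ r) = s :: bs.
Proof.
rewrite /split_blocks foldl_split_block -[[::] ++ [:: s]]cats0 foldl_split_done.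
by eexists.
Qed.

Lemma concat_blocksK : cancel concat_blocks split_blocks.
Proof.
move=> bs; suff split_bs done :
    (foldl split_step ([::], [::], done) (concat_blocks bs)).2 = done ++ bs.
  by rewrite /split_blocks split_bs.
elim: bs done => [|s bs IH] done; first by rewrite cats0.
by rewrite /concat_blocks /= -/(concat_blocks bs) foldl_split_block IH -catA.
Qed.

Section Triples.

Variables (T : Type) (x0 : T).

Definition triple_step (p : seq T * seq (T * T * T)) (x : T) :=
  if nilp (behead p.1) then (p.1 ++ [:: x], p.2)
  else ([::], p.2 ++ [:: (head x0 p.1, head x0 (behead p.1), x)]).

Definition triples (s : seq T) : seq (T * T * T) := (foldl triple_step ([::], [::]) s).2.

Lemma triples_flatten ts : triples (flatten [seq [:: t.1.1; t.1.2; t.2] | t <- ts]) = ts.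
Proof.
set fl := map _; suff triples_ts done :
    (foldl triple_step ([::], done) (flatten (fl ts))).2 = done ++ ts.
  by rewrite /triples triples_ts.
elim: ts done => [|[[a b] c] ts IH] done /=; first by rewrite cats0.
by rewrite /triple_step /= IH -catA.
Qed.

End Triples.

Definition block_lit (s : seq bool) : lit_over (seq bool) := (head false s, behead s).
Definition lit_block (l : lit_over (seq bool)) : seq bool := l.1 :: l.2.

Definition parse (w : seq bool) : seq (clause_over (seq bool)) :=
  [seq (block_lit t.1.1, block_lit t.1.2, block_lit t.2) | t <- triples [::] (split_blocks w)].

Definition unparse (F : seq (clause_over (seq bool))) : seq bool :=
  concat_blocks (map lit_block (all_lits F)).

Lemma unparseK : cancel unparse parse.
Proof.
move=> F; pose blocks_of (c : clause_over (seq bool)) :=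
  (lit_block c.1.1, lit_block c.1.2, lit_block c.2).
have def_blocks : map lit_block (all_lits F) =
    flatten [seq [:: t.1.1; t.1.2; t.2] | t <- map blocks_of F].
  by rewrite map_flatten -!map_comp.
rewrite /parse /unparse concat_blocksK def_blocks triples_flatten.
by apply: mapK => -[[[? ?] [? ?]] [? ?]].
Qed.

Lemma enc_formulaE F : enc_formula F = unparse (rename nat_bits F).
Proof.
elim: F => //= c F IH; rewrite /enc_formula /= -/(enc_formula F) IH clause_litsE.
by rewrite /unparse all_lits_cons map_cat /concat_blocks map_cat flatten_cat -!map_comp.
Qed.

(** * Names of variables *)

Fixpoint bits_pos (s : seq bool) : positive :=
  match s with
  | [::] => xH
  | true :: s' => xI (bits_pos s')
  | false :: s' => xO (bits_pos s')
  end.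

Definition bits_nat (s : seq bool) : nat := (Pos.to_nat (bits_pos s)).-1.

Lemma bits_natK : cancel bits_nat nat_bits.
Proof.
move=> s; rewrite /nat_bits /bits_nat.
have -> : Pos.of_succ_nat (Pos.to_nat (bits_pos s)).-1 = bits_pos s.
  apply: Pnat.Pos2Nat.inj; rewrite Pnat.SuccNat2Pos.id_succ.
  by have := Pnat.Pos2Nat.is_pos (bits_pos s); lia.
by elim: s => //= -[] s /= ->.
Qed.

Lemma pos_bits_inj : injective pos_bits.
Proof. by elim=> [p IH|p IH|] [q|q|] //= [/IH ->]. Qed.

Lemma nat_bits_inj : injective nat_bits.
Proof. by move=> m n /pos_bits_inj /Pnat.SuccNat2Pos.inj. Qed.

Lemma nat_bitsK : cancel nat_bits bits_nat.
Proof. exact: inj_can_sym bits_natK nat_bits_inj. Qed.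

Lemma enc_formula_inj : injective enc_formula.
Proof.
move=> F G; rewrite !enc_formulaE => /(can_inj unparseK).
by move=> /(can_inj (renameK nat_bitsK)).
Qed.

(** * Membership in NP *)

Definition certifies (names : seq (seq bool)) (w : seq bool) : bool :=
  [&& unparse (parse w) == w,
      constant [seq true_count (fun v => v \in names) c | c <- parse w]
    & all (fun l => occ (parse w) l.2 <= 4) (all_lits (parse w))].

Definition verifier (z : seq bool) : bool :=
  certifies (behead (split_blocks z)) (head [::] (split_blocks z)).

Lemma certifies_sound names w : certifies names w -> ATS_3CNF4 w.
Proof.
case/and3P=> /eqP parse_w same /allP occ_w.
have bits_nat_inj := can_inj bits_natK; exists (rename bits_nat (parse w)).
split; first by rewrite enc_formulaE (renameK bits_natK).
split=> [v|]; first by rewrite occurrencesE; apply: occ_rename_le; last exact: occ_le.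
apply/all_the_same_satE/(same_sat_rename bits_nat_inj)/same_satE.
by exists (fun v => v \in names).
Qed.

Lemma certifies_complete w : ATS_3CNF4 w ->
  exists2 names, size (concat_blocks names) <= size w & certifies names w.
Proof.
move=> [F [-> [occ_F /all_the_same_satE[val [k same]]]]].
pose names := [seq nat_bits l.2 | l <- all_lits F & val l.2].
exists names.
  rewrite enc_formulaE /unparse all_lits_rename /names -map_comp.
  elim: (all_lits F) => //= l s IH; rewrite /concat_blocks /= in IH *.
  by case: ifP => _ /=; rewrite !size_cat /=; lia.
rewrite /certifies enc_formulaE unparseK eqxx andTb; apply/andP; split.
  apply: (@all_pred1_constant _ k); rewrite -map_comp all_map; apply/allP => c Fc /=.
  rewrite -(eqP (allP same c Fc)) true_count_rename; apply/eqP/eq_true_count => l cl /=.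
  have Fl := mem_all_lits Fc cl.
  apply/mapP/idP => [[l' + /nat_bits_inj ->]|val_l]; first by rewrite mem_filter => /andP[].
  by exists l; rewrite // mem_filter val_l.
apply/allP => l _; apply: (occ_rename_le nat_bits_inj) => v.
by rewrite -occurrencesE; apply: occ_F.
Qed.

Section ParserPolytime.

Variable E : encType.

Lemma polytime_split_blocks (s : E -> seq bool) :
  polytime s -> polytime (fun e => split_blocks (s e)).
Proof.
move=> ps; apply: polytime_snd_of.
apply: (polytime_foldl (r := fun=> 10)).
- by rewrite /split_step; polytime.
- by polytime.
- by polytime.
- by poly_bounded.
- move=> e [[pending cur] bs] b; have := esize_bool b; have := esize_gt0 pending.
  have := esize_cat cur [:: b]; have := esize_cat bs [:: cur].
  rewrite /split_step /= !esize_cons !esize_nil.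
  by case: ifP => _; [|case: ifP => _]; rewrite !esize_pair ?esize_cons ?esize_nil; lia.
Qed.

Lemma polytime_triples (A : encType) (x0 : A) (s : E -> seq A) :
  polytime s -> polytime (fun e => triples x0 (s e)).
Proof.
move=> ps; apply: polytime_snd_of.
apply: (polytime_foldl (r := fun n => n + (2 * esize x0 + 10))).
- by rewrite /triple_step; polytime.
- by polytime.
- by polytime.
- by poly_bounded.
- move=> e [p done] b; have := esize_cat p [:: b].
  have := esize_cat done [:: (head x0 p, head x0 (behead p), b)].
  rewrite /triple_step /= !esize_cons !esize_nil; case: ifP; rewrite !esize_pair ?esize_nil.
    by lia.
  by case: p => [|x [|y p]] //=; rewrite !esize_cons; lia.
Qed.

End ParserPolytime.

#[export] Hint Extern 1 (polytime (fun e => split_blocks _)) =>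
  apply: polytime_split_blocks : polytime.
#[export] Hint Extern 1 (polytime (fun e => triples _ _)) => apply: polytime_triples : polytime.

Section FormulasPolytime.

Variables E V : encType.

Lemma polytime_all_lits (F : E -> seq (clause_over V)) :
  polytime F -> polytime (fun e => all_lits (F e)).
Proof. by move=> pF; rewrite /all_lits /lits; polytime. Qed.

Lemma polytime_concat_blocks (s : E -> seq (seq bool)) :
  polytime s -> polytime (fun e => concat_blocks (s e)).
Proof. by move=> ps; rewrite /concat_blocks /block /data_bits; polytime. Qed.

End FormulasPolytime.

#[export] Hint Extern 1 (polytime (fun e => all_lits _)) => apply: polytime_all_lits : polytime.
#[export] Hint Extern 1 (polytime (fun e => concat_blocks _)) =>
  apply: polytime_concat_blocks : polytime.

Section CodingPolytime.

Variable E : encType.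

Lemma polytime_unparse (F : E -> seq (clause_over (seq bool))) :
  polytime F -> polytime (fun e => unparse (F e)).
Proof. by move=> pF; rewrite /unparse /lit_block; polytime. Qed.

Lemma polytime_parse (w : E -> seq bool) : polytime w -> polytime (fun e => parse (w e)).
Proof. by move=> pw; rewrite /parse /block_lit; polytime. Qed.

End CodingPolytime.

#[export] Hint Extern 1 (polytime (fun e => unparse _)) => apply: polytime_unparse : polytime.
#[export] Hint Extern 1 (polytime (fun e => parse _)) => apply: polytime_parse : polytime.

Lemma polytime_verifier : polytime verifier.
Proof.
rewrite /verifier /certifies /true_count /true_lit /lits /occ.
by polytime.
Qed.

Theorem ATS_3CNF4_in_NP : in_NP ATS_3CNF4.
Proof.
exists (fun z => verifier z); split; first exact: polytime_in_P polytime_verifier.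
exists 1 => w; split=> [/certifies_complete[names le_names cert]|[y [_ cert]]].
  exists (concat_blocks names); split; first by rewrite /poly_bound; lia.
  have -> : pair_enc w (concat_blocks names) = concat_blocks (w :: names).
    by rewrite /pair_enc /concat_blocks /= /block -catA.
  by rewrite /verifier concat_blocksK.
have def_wy : pair_enc w y = block w ++ y by rewrite /pair_enc /block -catA.
have [bs split_wy] := split_blocks_block w y.
by move: cert; rewrite /verifier def_wy split_wy; apply: certifies_sound.
Qed.

(** * From 3-SAT to one-in-three satisfiability *)

Lemma all_flatten_map A B (p : pred B) (f : A -> seq B) (s : seq A) :
  all p (flatten (map f s)) = all (fun x => all p (f x)) s.
Proof. by elim: s => //= x s IH; rewrite all_cat IH. Qed.

Section OneInThree.

Variable V : Type.

Definition gadget_var := (V + clause_over V * nat)%type.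

Definition old_lit (l : lit_over V) : lit_over gadget_var := (l.1, inl l.2).
Definition old_neg (l : lit_over V) : lit_over gadget_var := (~~ l.1, inl l.2).
Definition new_lit (c : clause_over V) (i : nat) : lit_over gadget_var := (true, inr (c, i)).

(* Schaefer's gadget: x or y or z holds iff R(~x, a, b), R(y, b, c), R(~z, c, d)
   is solvable in a, b, c, d, where R means that exactly one argument is true. *)
Definition gadget (c : clause_over V) : seq (clause_over gadget_var) :=
  [:: (old_neg c.1.1, new_lit c 0, new_lit c 1);
      (old_lit c.1.2, new_lit c 1, new_lit c 2);
      (old_neg c.2, new_lit c 2, new_lit c 3)].

Definition one_in_three (C : seq (clause_over V)) : seq (clause_over gadget_var) :=
  flatten (map gadget C).

Definition gadget_val (val : V -> bool) (u : gadget_var) : bool :=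
  match u with
  | inl v => val v
  | inr (c, i) =>
      let x := true_lit val c.1.1 in
      let y := true_lit val c.1.2 in
      let z := true_lit val c.2 in
      nth false [:: x && y; ~~ y && x; ~~ y && ~~ x; z && (x || y)] i
  end.

Lemma gadget_complete val c :
  satisfied val c -> all (fun d => true_count (gadget_val val) d == 1) (gadget c).
Proof.
case: c => [[[s1 v1] [s2 v2]] [s3 v3]].
rewrite /satisfied /true_count /true_lit /= /true_lit /=.
by case: (val v1) (val v2) (val v3) s1 s2 s3 => [] [] [] [] [] [].
Qed.

Lemma gadget_sound val c :
  all (fun d => true_count val d == 1) (gadget c) -> satisfied (val \o inl) c.
Proof.
case: c => [[[s1 v1] [s2 v2]] [s3 v3]]; rewrite /satisfied /true_count /true_lit /=.
set c : clause_over V := (s1, v1, (s2, v2), (s3, v3)).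
move: (val (inr (c, 0))) (val (inr (c, 1))) (val (inr (c, 2))) (val (inr (c, 3))).
move: (val (inl v1)) (val (inl v2)) (val (inl v3)) s1 s2 s3 {c}.
by do 10!case.
Qed.

Lemma one_in_threeP C : sat C <-> one_sat (one_in_three C).
Proof.
split=> -[val]; rewrite ?all_flatten_map => sat_C.
  exists (gadget_val val); rewrite all_flatten_map.
  exact: sub_all (@gadget_complete val) _ sat_C.
by exists (val \o inl); apply: sub_all (@gadget_sound val) _ sat_C.
Qed.

End OneInThree.

(** * Bounding the number of occurrences *)

Lemma true_count_negb T (val : T -> bool) c :
  true_count (fun v => ~~ val v) c = 3 - true_count val c.
Proof.
rewrite -[3]/(size (lits c)) -(count_predC (true_lit val)) addKn; apply: eq_count => l.
by rewrite /true_lit /=; case: (val l.2) (l.1) => [] [].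
Qed.

Section BoundedOccurrences.

Variable W : eqType.

(* [inl (w, p)] is the copy of [w] number [p], [inr (w, p)] the constant that links
   it to the next one. *)
Definition copy_var := (W * nat + W * nat)%type.

Definition copy_lit (l : lit_over W) (p : nat) : lit_over copy_var := (l.1, inl (l.2, p)).

Definition spread (c : clause_over W) (j : nat) : clause_over copy_var :=
  (copy_lit c.1.1 (3 * j), copy_lit c.1.2 (3 * j).+1, copy_lit c.2 (3 * j).+2).

(* The second clause has [1 + f] true literals, so the common number is 1 or 2 and
   the first clause then forces the copies [p] and [p.+1] of the variable to agree. *)
Definition link (wp : W * nat) : seq (clause_over copy_var) :=
  let f := inr wp : copy_var in
  [:: ((true, inl wp), (false, inl (wp.1, wp.2.+1)), (true, f));
      ((true, f), (true, f), (false, f))].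

Variable c0 : clause_over W.

Definition spread_clauses (D : seq (clause_over W)) : seq (clause_over copy_var) :=
  [seq spread (nth c0 D j) j | j <- iota 0 (size D)].

Definition links (K : seq (W * nat)) : seq (clause_over copy_var) := flatten (map link K).

Definition copies (D : seq (clause_over W)) : seq (W * nat) :=
  [seq (w, p) | w <- undup [seq l.2 | l <- all_lits D], p <- iota 0 (3 * size D)].

Definition split_vars (D : seq (clause_over W)) : seq (clause_over copy_var) :=
  spread_clauses D ++ links (copies D).

Lemma copies_uniq D : uniq (copies D).
Proof. by apply: allpairs_uniq; rewrite ?undup_uniq ?iota_uniq // => -[? ?] [? ?]. Qed.

Lemma mem_copies D l p : l \in all_lits D -> p < 3 * size D -> (l.2, p) \in copies D.
Proof. by move=> Dl lt_p; apply: allpairs_f; rewrite ?mem_iota // mem_undup map_f. Qed.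

Definition position (u : copy_var) : nat := match u with inl (_, p) | inr (_, p) => p end.

Lemma spread_positions D :
  [seq position l.2 | l <- all_lits (spread_clauses D)] = iota 0 (3 * size D).
Proof.
suff positions m n :
    [seq position l.2 | l <- all_lits [seq spread (nth c0 D j) j | j <- iota m n]]
    = iota (3 * m) (3 * n) by rewrite /spread_clauses positions.
elim: n m => [|n IH] m; first by rewrite muln0.
rewrite -[iota m n.+1]/(m :: iota m.+1 n) map_cons all_lits_cons map_cat IH.
by rewrite !mulnS iotaD addnC.
Qed.

Lemma occ_spread_copy D w p : occ (spread_clauses D) (inl (w, p)) <= 1.
Proof.
have uniq_positions : count_mem p (iota 0 (3 * size D)) <= 1.
  by rewrite count_uniq_mem ?iota_uniq // leq_b1.
apply: leq_trans uniq_positions; rewrite -spread_positions count_map.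
by apply: sub_count => l /= /eqP ->; rewrite /= eqxx.
Qed.

Lemma occ_spread_constant D wp : occ (spread_clauses D) (inr wp) = 0.
Proof. by rewrite /occ /spread_clauses; elim: (iota _ _) => //= j s ->. Qed.

Lemma occ_links_copy K w p :
  occ (links K) (inl (w, p)) =
  count_mem (w, p) K + count (fun wq => (wq.1, wq.2.+1) == (w, p)) K.
Proof.
elim: K => // wq K IH.
rewrite -[links _]/(link wq ++ links K) occ_cat IH /occ /=.
by rewrite addn0 !(inj_eq inl_inj) /=; lia.
Qed.

Lemma occ_links_constant K wp : occ (links K) (inr wp) = 4 * count_mem wp K.
Proof.
elim: K => // wq K IH.
rewrite -[links _]/(link wq ++ links K) occ_cat IH /occ /=.
by rewrite !(inj_eq inr_inj) /=; lia.
Qed.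

Lemma split_vars_occ D u : occ (split_vars D) u <= 4.
Proof.
have once wp : count_mem wp (copies D) <= 1 by rewrite count_uniq_mem ?copies_uniq // leq_b1.
rewrite occ_cat; case: u => [[w p]|wp]; last first.
  by rewrite occ_spread_constant occ_links_constant; have := once wp; lia.
have once_next : count (fun wq => (wq.1, wq.2.+1) == (w, p)) (copies D) <= 1.
  apply: leq_trans (once (w, p.-1)); apply: sub_count => -[w' q] /= /eqP[-> <-].
  exact: eqxx.
rewrite occ_links_copy.
by apply: leq_trans (leq_add (occ_spread_copy D w p) (leq_add (once _) once_next)) _.
Qed.

Lemma link_true_count val k w p :
    all (fun c => true_count val c == k) (link (w, p)) ->
  0 < k < 3 /\ val (inl (w, p.+1)) = val (inl (w, p)).
Proof.
rewrite /= /true_count /true_lit /= andbT => /andP[/eqP + /eqP].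
by case: (val (inr _)) (val (inl _)) (val (inl _)) => [] [] [] /= <-.
Qed.

Lemma links_true_count D val k :
    all (fun c => true_count val c == k) (links (copies D)) ->
  forall l p, l \in all_lits D -> p < 3 * size D ->
    0 < k < 3 /\ val (inl (l.2, p)) = val (inl (l.2, 0)).
Proof.
rewrite all_flatten_map => /allP linked l p Dl lt_p.
have link_l q : q < 3 * size D -> 0 < k < 3 /\ val (inl (l.2, q.+1)) = val (inl (l.2, q)).
  by move=> lt_q; apply/link_true_count/linked/mem_copies.
split; first by case: (link_l p lt_p).
elim: p lt_p => // p IH lt_p.
by have [_ ->] := link_l p (ltnW lt_p); apply/IH/ltnW.
Qed.

Lemma spread_true_count val (val0 : W -> bool) c j :
    (forall l p, l \in lits c -> p < 3 * j.+1 -> val (inl (l.2, p)) = val0 l.2) ->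
  true_count val (spread c j) = true_count val0 c.
Proof.
move=> agree; rewrite /true_count /true_lit /= !agree ?inE ?eqxx ?orbT //; lia.
Qed.

Lemma split_vars_complete D : one_sat D -> same_sat (split_vars D).
Proof.
move=> [val /allP sat_D]; exists (fun u => if u is inl (w, _) then val w else false), 1.
rewrite all_cat all_flatten_map; apply/andP; split; apply/allP.
  move=> _ /mapP[j + ->]; rewrite mem_iota /= => lt_j.
  by rewrite (@spread_true_count _ val) // sat_D // mem_nth.
by move=> -[w p] _ /=; rewrite /true_count /true_lit /=; case: (val w).
Qed.

Lemma split_vars_sound D : same_sat (split_vars D) -> one_sat D.
Proof.
move=> [val [k]]; rewrite all_cat => /andP[/allP spread_D /links_true_count agree].
pose val0 w := val (inl (w, 0)).
have count_D c : c \in D -> true_count val0 c = k.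
  move=> Dc; have lt_c : index c D < size D by rewrite index_mem.
  have /spread_D/eqP <- : spread (nth c0 D (index c D)) (index c D) \in spread_clauses D.
    by apply: (map_f (fun j => spread (nth c0 D j) j)); rewrite mem_iota.
  rewrite nth_index //; symmetry; apply: spread_true_count => l p cl lt_p.
  have [|//] := agree l p (mem_all_lits Dc cl).
  by apply: leq_trans lt_p _; rewrite leq_mul.
have range_k c : c \in D -> 0 < k < 3.
  move=> Dc; have Dl : c.1.1 \in all_lits D by apply: mem_all_lits Dc _; rewrite inE eqxx.
  have [|//] := agree _ 0 Dl; by case: (D) Dc.
case: (eqVneq k 2) => [k2|neq_k2].
  exists (fun w => ~~ val0 w); apply/allP => c Dc.
  by rewrite true_count_negb count_D // k2.
exists val0; apply/allP => c Dc; rewrite count_D //.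
by have := range_k c Dc; lia.
Qed.

Lemma split_varsP D : one_sat D <-> same_sat (split_vars D).
Proof. by split; [apply: split_vars_complete | apply: split_vars_sound]. Qed.

End BoundedOccurrences.

(** * Renaming the variables by bit strings *)

Section Naming.

Variable U : encType.
Implicit Type G : seq (clause_over U).

Definition word G : seq bool := unparse (rename (@bits U) G).

Lemma ATS_3CNF4_word G : (forall u, occ G u <= 4) -> ATS_3CNF4 (word G) <-> same_sat G.
Proof.
move=> occ_G; pose number (u : U) := bits_nat (bits u).
have number_inj : injective number := inj_comp (can_inj bits_natK) (@bits_inj U).
have def_word : word G = enc_formula (rename number G).
  rewrite enc_formulaE /word /rename -map_comp; congr unparse; apply: eq_map => c /=.
  by rewrite /rename_clause /rename_lit /number /= !bits_natK.
split=> [[F []]|same].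
  rewrite def_word => /enc_formula_inj <- [_ /all_the_same_satE].
  by move/(same_sat_rename number_inj).
exists (rename number G); split=> //; split; last first.
  by apply/all_the_same_satE/(same_sat_rename number_inj).
by move=> v; rewrite occurrencesE; apply: occ_rename_le.
Qed.

End Naming.

Section Reduction.

Variables (V : encType) (c0 : clause_over (gadget_var V)).

Definition ats_word (C : seq (clause_over V)) : seq bool :=
  word (split_vars c0 (one_in_three C)).

Lemma ats_wordP C : ATS_3CNF4 (ats_word C) <-> sat C.
Proof.
by rewrite one_in_threeP (split_varsP c0); apply: ATS_3CNF4_word; apply: split_vars_occ.
Qed.

End Reduction.

Section ReductionPolytime.

Variables E V : encType.

Lemma polytime_one_in_three (C : E -> seq (clause_over V)) :
  polytime C -> polytime (fun e => one_in_three (C e)).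
Proof.
by move=> pC; rewrite /one_in_three /gadget /old_neg /old_lit /new_lit; polytime.
Qed.

Lemma polytime_split_vars (c0 : clause_over V) (D : E -> seq (clause_over V)) :
  polytime D -> polytime (fun e => split_vars c0 (D e)).
Proof.
move=> pD; rewrite /split_vars /spread_clauses /spread /copy_lit /links /link /copies.
by polytime.
Qed.

Lemma polytime_word (G : E -> seq (clause_over V)) :
  polytime G -> polytime (fun e => word (G e)).
Proof. by move=> pG; rewrite /word /rename /rename_clause /rename_lit; polytime. Qed.

End ReductionPolytime.

Lemma polytime_ats_word (V : encType) (c0 : clause_over (gadget_var V)) :
  polytime (ats_word c0).
Proof.
apply: polytime_word; apply: polytime_split_vars; apply: polytime_one_in_three.
exact: polytime_id.
Qed.

(** * The computation tableau *)

Lemma all_map_iotaP T (p : pred T) (f : nat -> T) n :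
  reflect (forall i, i < n -> p (f i)) (all p [seq f i | i <- iota 0 n]).
Proof.
rewrite all_map; apply: (iffP allP) => all_p i; last by rewrite mem_iota; apply: all_p.
by move=> lt_i; apply: all_p; rewrite mem_iota.
Qed.

Lemma all_flatten_iotaP T (p : pred T) (f : nat -> seq T) n :
  reflect (forall i, i < n -> all p (f i)) (all p (flatten [seq f i | i <- iota 0 n])).
Proof. by rewrite all_flatten_map -(all_map f (all p)); apply: all_map_iotaP. Qed.

Section Squares.

Variable M : TM.

(* Column 0 of the tableau is a border, marked [None]; column [j.+1] shows tape
   cell [j] together with the state if the head is there. *)
Definition square := option (sym M * option (state M)).

Definition square_at (c : tape_conf (state M) (sym M)) (i : nat) : square :=
  if i is j.+1 then Some (c.2 j, if c.1.2 == j then Some c.1.1 else None) else None.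

Definition action (q : state M) (s : sym M) : state M * sym M * move :=
  if tm_halts q then (q, s, MvS) else tm_delta q s.

Lemma tm_tape_stepE q h t (a := action q (t h)) :
  tm_tape_step (q, h, t) = (a.1.1, shift a.2 h, write t h a.1.2).
Proof.
rewrite /a /action /tm_tape_step /tape_step; case: ifP => _; first by rewrite /= write_same.
by case: (tm_delta q (t h)) => [[q' s] m].
Qed.

Definition head_action (g : square) : option (state M * move) :=
  if g is Some (s, Some q) then let a := action q s in Some (a.1.1, a.2) else None.

Definition incoming_state (x y z : square) : option (state M) :=
  match head_action x, head_action y, head_action z with
  | Some (q, MvR), _, _ => Some q
  | _, Some (q, MvS), _ => Some q
  | _, Some (q, MvL), _ => if x is None then Some q else None
  | _, _, Some (q, MvL) => Some q
  | _, _, _ => None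
  end.

Definition next_square (x y z : square) : square :=
  if y is Some (s, oq) then
    Some (if oq is Some q then (action q s).1.2 else s, incoming_state x y z)
  else None.

Lemma square_at_step c i :
  square_at (tm_tape_step c) i.+1 =
  next_square (square_at c i) (square_at c i.+1) (square_at c i.+2).
Proof.
case: c => [[q h] t]; rewrite tm_tape_stepE; set a := action q (t h).
have headE k : head_action (square_at (q, h, t) k) =
    if h.+1 == k then Some (a.1.1, a.2) else None.
  by case: k => //= k; rewrite eqSS; case: eqP => //= <-.
have -> : square_at (a.1.1, shift a.2 h, write t h a.1.2) i.+1 =
    Some (if h == i then a.1.2 else t i, if shift a.2 h == i then Some a.1.1 else None).
  by rewrite /= /write eq_sym.
rewrite /next_square [square_at _ i.+1]/=; congr (Some (_, _)).
  by case: eqP => // <-.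
rewrite /incoming_state -![Some (t i, _)]/(square_at (q, h, t) i.+1) !headE !eqSS.
case: a {headE} => [[q' b] m] /=.
by case: m; case: i => [|i] /=; rewrite ?eqSS; do ?[case: eqP => //=]; lia.
Qed.

End Squares.

Arguments square_at {M} : simpl never.

Section Tableau.

Variable M : TM.
Local Notation square := (square M).

Definition tvar := (nat * nat * square + nat * nat * (square * square))%type.
Definition cell_var (t i : nat) (g : square) : tvar := inl (t, i, g).
Definition pair_var (t i : nat) (x y : square) : tvar := inr (t, i, (x, y)).

Definition pos (v : tvar) : lit_over tvar := (true, v).
Definition neg (v : tvar) : lit_over tvar := (false, v).
Definition unit_clause (l : lit_over tvar) : clause_over tvar := (l, l, l).

Definition border : square := None.
Definition blank_square : square := Some (blank M, None).
Definition bit_square (b : bool) : square := Some (sym_of_bool M b, None).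
Definition start_square (b : bool) : square := Some (sym_of_bool M b, Some (tm_start M)).

Definition input_prefix (w : seq bool) : seq bool := data_bits w ++ [:: false; false].

Definition triple (g : square) : square * square * square := (g, g, g).

Definition first_row (w : seq bool) (B : nat) : seq (square * square * square) :=
  [:: triple border, triple (start_square (head false (input_prefix w)))
    & [seq triple (bit_square b) | b <- behead (input_prefix w)]]
  ++ nseq B (bit_square false, bit_square true, blank_square).

Definition init_clause (i : nat) (alt : square * square * square) : clause_over tvar :=
  (pos (cell_var 0 i alt.1.1), pos (cell_var 0 i alt.1.2), pos (cell_var 0 i alt.2)).

Definition init_clauses w B N : seq (clause_over tvar) :=
  [seq init_clause i (nth (triple blank_square) (first_row w B) i) | i <- iota 0 N].

Definition blank_clauses N : seq (clause_over tvar) :=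
  [seq (neg (cell_var 0 i blank_square), neg (cell_var 0 i blank_square),
        pos (cell_var 0 i.+1 blank_square)) | i <- iota 0 N].

Definition border_clauses T : seq (clause_over tvar) :=
  [seq unit_clause (pos (cell_var t 0 border)) | t <- iota 0 T.+1].

Definition windows : seq ((square * square) * (square * square)) :=
  [seq (p.1, (p.2, next_square p.1.1 p.1.2 p.2)) | p <- enum {: (square * square) * square}].

Definition window_clauses (t i : nat) (r : (square * square) * (square * square)) :
    seq (clause_over tvar) :=
  [:: (neg (cell_var t i r.1.1), neg (cell_var t i.+1 r.1.2), pos (pair_var t i r.1.1 r.1.2));
      (neg (pair_var t i r.1.1 r.1.2), neg (cell_var t i.+2 r.2.1),
       pos (cell_var t.+1 i.+1 r.2.2))].

Definition step_clauses T N : seq (clause_over tvar) :=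
  flatten [seq flatten [seq flatten [seq window_clauses t i r | r <- windows] | i <- iota 0 N]
          | t <- iota 0 T].

Definition unaccepting (g : square) : bool :=
  if g is Some (_, Some q) then q != tm_acc M else false.

Definition final_clauses T N : seq (clause_over tvar) :=
  flatten [seq [seq unit_clause (neg (cell_var T i g)) | g <- enum unaccepting]
          | i <- iota 0 N].

Definition tableau w T B N : seq (clause_over tvar) :=
  init_clauses w B N ++ blank_clauses N ++ border_clauses T ++ step_clauses T N
  ++ final_clauses T N.

Section Satisfaction.

Variable val : tvar -> bool.

Lemma satisfiedE a b c :
  satisfied val (a, b, c) = [|| true_lit val a, true_lit val b | true_lit val c].
Proof. by rewrite /satisfied /true_count /=; do 3!case: (true_lit _ _). Qed.

Lemma true_pos v : true_lit val (pos v) = val v.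
Proof. by rewrite /true_lit /=; case: (val v). Qed.

Lemma true_neg v : true_lit val (neg v) = ~~ val v.
Proof. by rewrite /true_lit /=; case: (val v). Qed.

Definition satE := (satisfiedE, true_pos, true_neg).

Lemma satisfied_hornP u v x :
  reflect (val u -> val v -> val x) (satisfied val (neg u, neg v, pos x)).
Proof.
rewrite !satE; case: (val u) (val v) (val x) => [] [] []; constructor=> //.
by move/(_ isT isT).
Qed.

Lemma init_clausesP w B N :
  reflect (forall i, i < N -> let alt := nth (triple blank_square) (first_row w B) i in
             [|| val (cell_var 0 i alt.1.1), val (cell_var 0 i alt.1.2)
               | val (cell_var 0 i alt.2)])
          (all (satisfied val) (init_clauses w B N)).
Proof. by apply: (iffP (all_map_iotaP _ _ _)) => init i /init; rewrite !satE. Qed.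

Lemma blank_clausesP N :
  reflect (forall i, i < N ->
             val (cell_var 0 i blank_square) -> val (cell_var 0 i.+1 blank_square))
          (all (satisfied val) (blank_clauses N)).
Proof.
apply: (iffP (all_map_iotaP _ _ _)) => blank i lt_i.
  by move=> blank_i; apply: (satisfied_hornP _ _ _ (blank i lt_i)).
by apply/satisfied_hornP => blank_i _; apply: blank.
Qed.

Lemma border_clausesP T :
  reflect (forall t, t <= T -> val (cell_var t 0 border)) (all (satisfied val) (border_clauses T)).
Proof. by apply: (iffP (all_map_iotaP _ _ _)) => bordered t /bordered; rewrite !satE !orbb. Qed.

Lemma step_clausesP T N :
  reflect (forall t i x y z, t < T -> i < N ->
             (val (cell_var t i x) -> val (cell_var t i.+1 y) -> val (pair_var t i x y)) /\
             (val (pair_var t i x y) -> val (cell_var t i.+2 z) ->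
              val (cell_var t.+1 i.+1 (next_square x y z))))
          (all (satisfied val) (step_clauses T N)).
Proof.
have windowP t i x y z : reflect
    ((val (cell_var t i x) -> val (cell_var t i.+1 y) -> val (pair_var t i x y)) /\
     (val (pair_var t i x y) -> val (cell_var t i.+2 z) ->
      val (cell_var t.+1 i.+1 (next_square x y z))))
    (all (satisfied val) (window_clauses t i ((x, y), (z, next_square x y z)))).
  rewrite /= andbT; apply: (iffP andP) => -[pair next]; split; try exact/satisfied_hornP.
apply: (iffP (all_flatten_iotaP _ _ _)) => [steps t i x y z lt_t lt_i|steps t lt_t].
  apply/windowP; have /all_flatten_iotaP/(_ i lt_i) := steps t lt_t.
  by rewrite all_flatten_map all_map => /allP/(_ (x, y, z)); apply; rewrite mem_enum.
apply/all_flatten_iotaP => i lt_i; rewrite all_flatten_map all_map.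
by apply/allP => -[[x y] z] _; apply/windowP/steps.
Qed.

Lemma final_clausesP T N :
  reflect (forall i g, i < N -> unaccepting g -> ~~ val (cell_var T i g))
          (all (satisfied val) (final_clauses T N)).
Proof.
apply: (iffP (all_flatten_iotaP _ _ _)) => [final i g lt_i bad_g|final i lt_i].
  have := final i lt_i; rewrite all_map => /allP/(_ g).
  by rewrite mem_enum /= !satE !orbb; apply.
by rewrite all_map; apply/allP => g; rewrite mem_enum /= !satE !orbb; apply: final.
Qed.

End Satisfaction.

Lemma pair_encE w y : pair_enc w y = input_prefix w ++ y.
Proof. by rewrite /input_prefix -catA. Qed.

Lemma size_input_prefix w : size (input_prefix w) = 2 * size w + 2.
Proof.
rewrite size_cat /=; congr addn.
by elim: w => //= b w IH; rewrite /data_bits /= in IH *; lia.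
Qed.

Section FirstRow.

Variables (w : seq bool) (B : nat).
Let P := size (input_prefix w).

Lemma size_input_prefix_gt0 : 0 < P. Proof. by rewrite /P size_input_prefix addn2. Qed.

Lemma nth_first_row_prefix j : j < P ->
  nth (triple blank_square) (first_row w B) j.+1 =
  triple (Some (sym_of_bool M (nth false (input_prefix w) j),
                if j == 0 then Some (tm_start M) else None)).
Proof.
rewrite /first_row /P; case: (input_prefix w) => //= b s; case: j => //= j lt_j.
by rewrite nth_cat size_map -ltnS lt_j (nth_map false).
Qed.

Lemma nth_first_row_guess j : P <= j < P + B ->
  nth (triple blank_square) (first_row w B) j.+1 =
  (bit_square false, bit_square true, blank_square).
Proof.
have := size_input_prefix_gt0; rewrite /first_row /P; case: (input_prefix w) => //= b s _.
case: j => //= j /andP[le_j lt_j].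
by rewrite nth_cat size_map ltnNge -ltnS le_j /= nth_nseq ltn_subLR // -ltnS lt_j.
Qed.

Lemma nth_first_row_blank j : P + B <= j ->
  nth (triple blank_square) (first_row w B) j.+1 = triple blank_square.
Proof.
have := size_input_prefix_gt0; rewrite /P => P_gt0 le_j; rewrite nth_default // /first_row.
case: (input_prefix w) P_gt0 le_j => //= b s _ le_j.
by rewrite size_cat size_map size_nseq.
Qed.

Variable y : seq bool.
Let c0 := tm_tape_init M (pair_enc w y).

Lemma square_at_init j :
  square_at c0 j.+1 = Some (nth (blank M) (map (@sym_of_bool M) (input_prefix w ++ y)) j,
                            if j == 0 then Some (tm_start M) else None).
Proof. by rewrite /c0 pair_encE /square_at /= eq_sym. Qed.

Lemma square_at_init_prefix j : j < P ->
  nth (triple blank_square) (first_row w B) j.+1 = triple (square_at c0 j.+1).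
Proof.
move=> lt_j; rewrite nth_first_row_prefix // square_at_init map_cat nth_cat size_map lt_j.
by rewrite (nth_map false).
Qed.

Lemma square_at_init_guess j : P <= j < P + size y ->
  square_at c0 j.+1 = bit_square (nth false y (j - P)).
Proof.
case/andP=> le_j lt_j; rewrite square_at_init (nth_map false); last by rewrite size_cat.
by rewrite nth_cat ltnNge le_j gtn_eqF // (leq_trans size_input_prefix_gt0).
Qed.

Lemma square_at_init_blank j : P + size y <= j -> square_at c0 j.+1 = blank_square.
Proof.
move=> le_j; rewrite square_at_init nth_default; last by rewrite size_map size_cat.
by rewrite gtn_eqF // (leq_trans size_input_prefix_gt0) // (leq_trans (leq_addr _ _) le_j).
Qed.

End FirstRow.

Definition accepting w T B : Prop :=
  exists2 y, size y <= B
           & (iter T (@tm_tape_step M) (tm_tape_init M (pair_enc w y))).1.1 = tm_acc M.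

Section Soundness.

Variables (val : tvar -> bool) (w : seq bool) (T B N : nat).

(* The input guessed by a model is read off up to the first blank. *)
Lemma first_row_sound :
    (size (input_prefix w) + B).+1 < N ->
    all (satisfied val) (init_clauses w B N) -> all (satisfied val) (blank_clauses N) ->
  exists2 y, size y <= B &
    forall i, i < N -> val (cell_var 0 i (square_at (tm_tape_init M (pair_enc w y)) i)).
Proof.
set P := size (input_prefix w) => lt_N /init_clausesP init /blank_clausesP blank.
pose ends m := val (cell_var 0 (P + m).+1 blank_square); pose n := find ends (iota 0 B).
have le_n : n <= B by rewrite -[X in _ <= X](size_iota 0) find_size.
have ends_n : ends n.
  case: (ltnP n B) => [lt_n|ge_n].
    have has_end : has ends (iota 0 B) by rewrite has_find size_iota.
    by have := nth_find 0 has_end; rewrite nth_iota.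
  have := init _ lt_N; rewrite nth_first_row_blank //= !orbb.
  by rewrite /ends (_ : n = B) //; lia.
pose y := mkseq (fun m => val (cell_var 0 (P + m).+1 (bit_square true))) n.
have size_y : size y = n by rewrite size_mkseq.
exists y => [|i lt_i]; first by rewrite size_y.
case: i lt_i => [|j] lt_j; first by have := init 0 lt_j; rewrite /= !orbb.
case: (ltnP j P) => [lt_jP|le_Pj].
  by have := init _ lt_j; rewrite (square_at_init_prefix _ y) //= !orbb.
case: (ltnP j (P + n)) => [lt_jn|le_nj].
  have lt_jP : j - P < n by rewrite ltn_subLR.
  rewrite square_at_init_guess ?size_y -/P ?le_Pj // nth_mkseq // subnKC //.
  have := init _ lt_j; rewrite nth_first_row_guess /=; last by rewrite -/P; lia.
  have := before_find 0 lt_jP; rewrite nth_iota ?add0n; last by lia.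
  rewrite /ends subnKC // => ->; rewrite orbF.
  by case bit: (val (cell_var 0 j.+1 (bit_square true))); rewrite ?bit // orbF.
rewrite square_at_init_blank ?size_y //.
elim: j le_nj lt_j {le_Pj} => [|j IH]; first by have := size_input_prefix_gt0 w; lia.
rewrite leq_eqVlt => /orP[/eqP <- _|le_nj lt_j]; first exact: ends_n.
by apply: blank; [lia | apply: IH; lia].
Qed.

Lemma rows_sound (c : nat -> tape_conf (state M) (sym M)) :
    (forall t, c t.+1 = tm_tape_step (c t)) ->
    all (satisfied val) (border_clauses T) -> all (satisfied val) (step_clauses T N) ->
    (forall i, i < N -> val (cell_var 0 i (square_at (c 0) i))) ->
  forall t i, t <= T -> i + t < N -> val (cell_var t i (square_at (c t) i)).
Proof.
move=> c_step /border_clausesP bordered /step_clausesP steps row0; elim=> [|t IH] i le_t lt_i.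
  by apply: row0; rewrite -[i]addn0.
case: i lt_i => [|i] lt_i; first exact: bordered.
rewrite c_step square_at_step.
have lt_iN : i < N by lia.
have [pair next] :=
  steps t i (square_at (c t) i) (square_at (c t) i.+1) (square_at (c t) i.+2) le_t lt_iN.
by apply: next; [apply: pair|]; apply: IH; lia.
Qed.

Lemma tableau_sound :
    2 * T + size (input_prefix w) + B + 2 < N -> all (satisfied val) (tableau w T B N) ->
  accepting w T B.
Proof.
move=> lt_N; rewrite /tableau !all_cat => /and5P[init blank bordered steps final].
have [|y le_y row0] := first_row_sound _ init blank; first by lia.
exists y => //; pose c t := iter t (@tm_tape_step M) (tm_tape_init M (pair_enc w y)).
have le_head : (c T).1.2 <= 0 + T by apply: iter_tape_step_head.
have lt_head : (c T).1.2.+1 + T < N by lia.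
have := rows_sound (c := c) (fun t => erefl) bordered steps row0 (leqnn T) lt_head.
rewrite /square_at eqxx -/(c T) => last_row.
apply/eqP; apply: contraLR last_row => rejecting.
by apply: (final_clausesP _ _ _ final) => //; lia.
Qed.

End Soundness.

Section Completeness.

Variables (w y : seq bool) (T B N : nat).
Hypothesis le_y : size y <= B.

Let c t := iter t (@tm_tape_step M) (tm_tape_init M (pair_enc w y)).

Definition run_val (v : tvar) : bool :=
  match v with
  | inl (t, i, g) => g == square_at (c t) i
  | inr (t, i, (x, z)) => (x == square_at (c t) i) && (z == square_at (c t) i.+1)
  end.

Lemma init_complete : all (satisfied run_val) (init_clauses w B N).
Proof.
apply/init_clausesP => -[//|j] _.
set P := size (input_prefix w); case: (ltnP j P) => [lt_j|le_Pj].
  by rewrite (square_at_init_prefix _ y) //= eqxx.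
case: (ltnP j (P + B)) => [lt_j|le_j].
  rewrite nth_first_row_guess ?le_Pj //=; case: (ltnP j (P + size y)) => [lt_jy|le_yj].
    rewrite square_at_init_guess -/P ?le_Pj //.
    by case: (nth false y (j - P)); rewrite eqxx ?orbT.
  by rewrite square_at_init_blank // eqxx !orbT.
rewrite nth_first_row_blank //= square_at_init_blank ?eqxx //.
by apply: leq_trans le_j; rewrite leq_add2l.
Qed.

Lemma blank_complete : all (satisfied run_val) (blank_clauses N).
Proof.
apply/blank_clausesP => -[|j] _ //= /eqP.
rewrite square_at_init => -[blank_j _].
have le_j : size (input_prefix w ++ y) <= j.
  rewrite leqNgt; apply/negP => lt_j; move: blank_j; rewrite (nth_map false) //.
  by move/(congr1 (@bit_of_sym M)); rewrite bit_of_symK.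
by rewrite square_at_init_blank // -size_cat leqW.
Qed.

Lemma border_complete : all (satisfied run_val) (border_clauses T).
Proof. exact/border_clausesP. Qed.

Lemma step_complete : all (satisfied run_val) (step_clauses T N).
Proof.
apply/step_clausesP => t i x1 x2 x3 _ _; split=> /=; first by move=> -> ->.
by move=> /andP[/eqP-> /eqP->] /eqP->; rewrite -square_at_step.
Qed.

Lemma final_complete : (c T).1.1 = tm_acc M -> all (satisfied run_val) (final_clauses T N).
Proof.
move=> acc_T; apply/final_clausesP => -[|i] g _ /= bad_g; apply: contraTN bad_g => /eqP-> //.
by rewrite /square_at /=; case: ifP => //= _; rewrite acc_T eqxx.
Qed.

End Completeness.

Lemma tableauP w T B N :
    2 * T + size (input_prefix w) + B + 2 < N ->
  accepting w T B <-> sat (tableau w T B N).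
Proof.
move=> lt_N; split=> [[y le_y acc_T]|[val]]; last exact: tableau_sound.
exists (run_val w y); rewrite !all_cat init_complete // blank_complete.
by rewrite border_complete step_complete final_complete.
Qed.

Lemma polytime_first_row (E : encType) (w : E -> seq bool) (B : E -> nat) :
  polytime w -> polytime B -> polytime (fun e => first_row (w e) (B e)).
Proof.
move=> pw pB; have p_start := polytime_of_bool start_square.
have p_bit := polytime_of_bool bit_square.
by rewrite /first_row /triple /input_prefix /data_bits; polytime.
Qed.

#[local] Hint Extern 1 (polytime (fun e => first_row _ _)) =>
  apply: polytime_first_row : polytime.

Lemma polytime_tableau (E : encType) (w : E -> seq bool) (T B N : E -> nat) :
    polytime w -> polytime T -> polytime B -> polytime N ->
  polytime (fun e => tableau (w e) (T e) (B e) (N e)).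
Proof.
move=> pw pT pB pN; rewrite /tableau /init_clauses /init_clause /blank_clauses.
rewrite /border_clauses /step_clauses /window_clauses /final_clauses /unit_clause.
rewrite /pos /neg /cell_var /pair_var.
by polytime.
Qed.

End Tableau.

(** * Cook's theorem *)

Lemma leq_poly_bound k m n : m <= n -> poly_bound k m <= poly_bound k n.
Proof. by move=> le_mn; rewrite /poly_bound leq_add2r leq_mul2l leq_expn2r ?orbT. Qed.

Section CookLevin.

Variables (M : TM) (k l : nat).

Definition guess_bound (w : seq bool) : nat := poly_bound l (size w).
Definition time_bound (w : seq bool) : nat := poly_bound k (2 * size w + 2 + guess_bound w).
Definition width (w : seq bool) : nat :=
  2 * time_bound w + (2 * size w + 2) + guess_bound w + 3.

Definition cook_formula (w : seq bool) : seq (clause_over (tvar M)) :=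
  tableau M w (time_bound w) (guess_bound w) (width w).

Lemma polytime_cook_formula : polytime cook_formula.
Proof.
have p_guess : polytime guess_bound by rewrite /guess_bound; polytime.
have p_time : polytime time_bound by rewrite /time_bound; polytime.
have p_width : polytime width by rewrite /width; polytime.
by apply: polytime_tableau; polytime.
Qed.

Lemma accepting_verified (V : language) w :
    (forall z, let c := @run M (poly_bound k (size z)) (@init M z) in
       halted c /\ ((c.1 == tm_acc M) <-> V z)) ->
  accepting M w (time_bound w) (guess_bound w) <->
  exists y, size y <= guess_bound w /\ V (pair_enc w y).
Proof.
move=> decides_V.
suff accepts_pair y : size y <= guess_bound w ->
    (iter (time_bound w) (@tm_tape_step M) (tm_tape_init M (pair_enc w y))).1.1 = tm_acc M
    <-> V (pair_enc w y).
  split=> [[y le_y /(accepts_pair y le_y) V_y]|[y [le_y /(accepts_pair y le_y) acc]]].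
    by exists y.
  by exists y.
move=> le_y; set z := pair_enc w y; have [halt_z <-] := decides_V z.
have le_time : poly_bound k (size z) <= time_bound w.
  by apply: leq_poly_bound; rewrite /z pair_encE size_cat size_input_prefix; lia.
have state_z := represents_state (represents_run (poly_bound k (size z)) (represents_init M z)).
have halt_tape :
    tm_halts (iter (poly_bound k (size z)) (@tm_tape_step M) (tm_tape_init M z)).1.1.
  by rewrite -state_z.
by rewrite [iter _ _ _](iter_tape_step_stable halt_tape le_time) -state_z; split=> /eqP.
Qed.

End CookLevin.

Theorem cook_levin L : in_NP L ->
  exists M (C : seq bool -> seq (clause_over (tvar M))),
    polytime C /\ forall w, L w <-> sat (C w).
Proof.
move=> [V [[M [k decides_V]] [l witness_L]]]; exists M, (cook_formula M k l).
split=> [|w]; first exact: polytime_cook_formula.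
rewrite witness_L -(accepting_verified _ _ decides_V); apply: tableauP.
by rewrite size_input_prefix /width; lia.
Qed.

Theorem ATS_3CNF4_NP_hard : NP_hard ATS_3CNF4.
Proof.
move=> L /cook_levin[M [C [pC CP]]].
pose c0 : clause_over (gadget_var (tvar M)) :=
  let l := (true, inl (cell_var 0 0 (border M))) in (l, l, l).
exists (fun w => ats_word c0 (C w)); split.
  exact/polytime_in_FP/(polytime_comp (polytime_ats_word c0) pC).
by move=> w; rewrite CP ats_wordP.
Qed.

Theorem theorem3 : NP_complete ATS_3CNF4.
Proof. by split; [apply: ATS_3CNF4_in_NP | apply: ATS_3CNF4_NP_hard]. Qed.
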